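(* Let $\Omega\subseteq\mathbb{H}$ be a symmetric slice domain and let $f$ be semiregular in $\Omega$. In each sphere $x+y\mathbb{S}\subset\Omega$ (with $x,y\in\mathbb{R}$), all the poles have the same order $\mathrm{ord}_f$ with the possible exception of one, which must have lesser order. That is, there is $N\in\mathbb{N}$ such that $\mathrm{ord}_f(q)=N$ for all $q\in x+y\mathbb{S}$, with the possible exception of a single point of $x+y\mathbb{S}$, at which $\mathrm{ord}_f$ is less than $N$.
   Context: $\mathbb{H}$ denotes the quaternions, $\mathbb{S}=\{q\in\mathbb{H}:q^2=-1\}$, and $x+y\mathbb{S}=\{x+Jy:J\in\mathbb{S}\}$. For $\Omega\subseteq\mathbb{H}$ and $I\in\mathbb{S}$ put $\Omega_I=\Omega\cap(\mathbb{R}+I\mathbb{R})$ and $f_I=f|_{\Omega_I}$. A function $f:\Omega\to\mathbb{H}$ on an open set is regular if for all $I\in\mathbb{S}$, $f_I$ has continuous partial derivatives and $\frac12\left(\frac{\partial}{\partial x}+I\frac{\partial}{\partial y}\right)f_I(x+Iy)\equiv0$. A set is symmetric if together with each $x+Iy$ it contains $x+y\mathbb{S}$. A domain (connected open set) $\Omega$ is a slice domain if it meets the real axis and every $\Omega_I$ is a domain in $\mathbb{R}+I\mathbb{R}$. For $p\in\mathbb{R}+I\mathbb{R}$ and $n\in\mathbb{Z}$, $(q-p)^{*n}$ is the regular function (on $\mathbb{H}$ if $n\ge0$, on $\mathbb{H}$ minus the sphere $x+y\mathbb{S}$ through $p$ if $n<0$) whose restriction to $\mathbb{R}+I\mathbb{R}$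 is $(z-p)^n$. Singularities. Put $\sigma(q,p)=\tau(q,p)=|q-p|$ if $p,q$ lie on a common complex line $\mathbb{R}+I\mathbb{R}$, and otherwise $\sigma(q,p)=\sqrt{(\mathrm{Re}\,q-\mathrm{Re}\,p)^2+(|\mathrm{Im}\,q|+|\mathrm{Im}\,p|)^2}$, $\tau(q,p)=\sqrt{(\mathrm{Re}\,q-\mathrm{Re}\,p)^2+(|\mathrm{Im}\,q|-|\mathrm{Im}\,p|)^2}$. Let $\Sigma(p,0,R)=\{q:\tau(q,p)>0,\ \sigma(q,p)<R\}$. If $f$ is regular on a symmetric slice domain $\Omega'$, a point $p\in\mathbb{H}$ is a singularity for $f$ if $\Sigma(p,0,R)\subseteq\Omega'$ for some $R>0$; then $f(q)=\sum_{n\in\mathbb{Z}}(q-p)^{*n}a_n$ in $\Sigma(p,0,R)$, whose restriction to the complex line $\mathbb{R}+I\mathbb{R}$ through $p$ is the Laurent expansion $f_I(z)=\sum_{n\in\mathbb{Z}}(z-p)^na_n$ in $0<|z-p|<R$. The point $p$ is a pole if there is $m\ge0$ with $a_{-k}=0$ for all $k>m$; the least such $m$ is $\mathrm{ord}_f(p)$. Poles of order $0$ are allowed; in particular $\mathrm{ord}_f(p)=0$ if $f$ is regular near $p$. The point $p$ is removable if $f$ extends to a neighborhood of $p$ as a regular function. A function is semiregular in a symmetric slice domain $\Omega$ if it is regular in a symmetric slice domain $\Omega'\subseteq\Omega$ such that every point of $\Omega\setminus\Omega'$ is a pole or a removable singularity for it. *)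

(* Defs.v *)
From Stdlib Require Import Reals ZArith Lra ClassicalEpsilon.
From Coquelicot Require Import Coquelicot.

Open Scope R_scope.

(** * Quaternions *)

(* [(a, b, c, d)] stands for [a + b i + c j + d k].  The topology is the
   product one; all the algebraic structures share one additive group. *)
Definition quat : Type := (R * R * R * R)%type.

Lemma quat_ext (a b c d a' b' c' d' : R) :
  a = a' -> b = b' -> c = c' -> d = d' ->
  ((a, b, c, d) : quat) = (a', b', c', d').
Proof. now intros -> -> -> ->. Qed.

Definition qplus (p q : quat) : quat :=
  let '(a1, b1, c1, d1) := p in
  let '(a2, b2, c2, d2) := q in
  (a1 + a2, b1 + b2, c1 + c2, d1 + d2).

Definition qopp (q : quat) : quat := let '(a, b, c, d) := q in (- a, - b, - c, - d).

Definition qmul (p q : quat) : quat :=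
  let '(a1, b1, c1, d1) := p in
  let '(a2, b2, c2, d2) := q in
  (a1 * a2 - b1 * b2 - c1 * c2 - d1 * d2,
   a1 * b2 + b1 * a2 + c1 * d2 - d1 * c2,
   a1 * c2 - b1 * d2 + c1 * a2 + d1 * b2,
   a1 * d2 + b1 * c2 - c1 * b2 + d1 * a2).

Definition qscal (x : R) (q : quat) : quat :=
  let '(a, b, c, d) := q in (x * a, x * b, x * c, x * d).

Definition quat_of_R (x : R) : quat := (x, 0, 0, 0).

Definition qnormsq (q : quat) : R :=
  let '(a, b, c, d) := q in a ^ 2 + b ^ 2 + c ^ 2 + d ^ 2.

Definition qabs (q : quat) : R := sqrt (qnormsq q).

Ltac quat_ring :=
  intros;
  repeat match goal with q : quat |- _ => destruct q as [[[? ?] ?] ?] end;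
  apply quat_ext; simpl; ring.

Lemma qplus_comm (p q : quat) : qplus p q = qplus q p.
Proof. quat_ring. Qed.

Lemma qplus_assoc (p q r : quat) : qplus p (qplus q r) = qplus (qplus p q) r.
Proof. quat_ring. Qed.

Lemma qplus_0_r (p : quat) : qplus p (quat_of_R 0) = p.
Proof. quat_ring. Qed.

Lemma qplus_opp_r (p : quat) : qplus p (qopp p) = quat_of_R 0.
Proof. quat_ring. Qed.

Definition quat_AbelianMonoid_mixin : AbelianMonoid.mixin_of quat :=
  AbelianMonoid.Mixin quat qplus (quat_of_R 0) qplus_comm qplus_assoc qplus_0_r.

Canonical quat_AbelianMonoid : AbelianMonoid :=
  AbelianMonoid.Pack quat quat_AbelianMonoid_mixin quat.

Definition quat_AbelianGroup_mixin : AbelianGroup.mixin_of quat_AbelianMonoid :=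
  AbelianGroup.Mixin quat_AbelianMonoid qopp qplus_opp_r.

Definition quat_AbelianGroup_class : AbelianGroup.class_of quat :=
  AbelianGroup.Class quat quat_AbelianMonoid_mixin quat_AbelianGroup_mixin.

Canonical quat_AbelianGroup : AbelianGroup :=
  AbelianGroup.Pack quat quat_AbelianGroup_class quat.

Lemma qmul_assoc (p q r : quat) : qmul p (qmul q r) = qmul (qmul p q) r.
Proof. quat_ring. Qed.

Lemma qmul_1_r (p : quat) : qmul p (quat_of_R 1) = p.
Proof. quat_ring. Qed.

Lemma qmul_1_l (p : quat) : qmul (quat_of_R 1) p = p.
Proof. quat_ring. Qed.

Lemma qmul_plus_r (p q r : quat) :
  qmul (qplus p q) r = qplus (qmul p r) (qmul q r).
Proof. quat_ring. Qed.

Lemma qmul_plus_l (p q r : quat) :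
  qmul p (qplus q r) = qplus (qmul p q) (qmul p r).
Proof. quat_ring. Qed.

Definition quat_Ring_mixin : Ring.mixin_of quat_AbelianGroup :=
  Ring.Mixin quat_AbelianGroup qmul (quat_of_R 1)
    qmul_assoc qmul_1_r qmul_1_l qmul_plus_r qmul_plus_l.

Canonical quat_Ring : Ring :=
  Ring.Pack quat (Ring.Class quat quat_AbelianGroup_class quat_Ring_mixin) quat.

Lemma qscal_assoc (x y : R) (q : quat) : qscal x (qscal y q) = qscal (x * y) q.
Proof. quat_ring. Qed.

Lemma qscal_1 (q : quat) : qscal 1 q = q.
Proof. quat_ring. Qed.

Lemma qscal_plus_l (x : R) (p q : quat) :
  qscal x (qplus p q) = qplus (qscal x p) (qscal x q).
Proof. quat_ring. Qed.

Lemma qscal_plus_r (x y : R) (q : quat) :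
  qscal (x + y) q = qplus (qscal x q) (qscal y q).
Proof. quat_ring. Qed.

Definition quat_ModuleSpace_mixin : ModuleSpace.mixin_of R_Ring quat_AbelianGroup :=
  ModuleSpace.Mixin R_Ring quat_AbelianGroup qscal
    qscal_assoc qscal_1 qscal_plus_l qscal_plus_r.

Definition quat_ModuleSpace_class : ModuleSpace.class_of R_Ring quat :=
  ModuleSpace.Class R_Ring quat quat_AbelianGroup_class quat_ModuleSpace_mixin.

Canonical quat_ModuleSpace : ModuleSpace R_Ring :=
  ModuleSpace.Pack R_Ring quat quat_ModuleSpace_class quat.

Definition quat_UniformSpace_mixin : UniformSpace.mixin_of quat :=
  UniformSpace.class
    (prod_UniformSpace
       (prod_UniformSpace (prod_UniformSpace R_UniformSpace R_UniformSpace)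
          R_UniformSpace) R_UniformSpace).

Canonical quat_UniformSpace : UniformSpace :=
  UniformSpace.Pack quat quat_UniformSpace_mixin quat.

Definition quat_NormedModuleAux_class : NormedModuleAux.class_of R_AbsRing quat :=
  NormedModuleAux.Class R_AbsRing quat quat_ModuleSpace_class
    quat_UniformSpace_mixin.

Canonical quat_NormedModuleAux : NormedModuleAux R_AbsRing :=
  NormedModuleAux.Pack R_AbsRing quat quat_NormedModuleAux_class quat.

Lemma qnormsq_ge_0 (q : quat) : 0 <= qnormsq q.
Proof. destruct q as [[[a b] c] d]; simpl; nra. Qed.

Lemma qabs_triangle (p q : quat) : qabs (qplus p q) <= qabs p + qabs q.
Proof.
assert (Hp := sqrt_pos (qnormsq p)); assert (Hq := sqrt_pos (qnormsq q)).
apply Rsqr_incr_0_var; [|unfold qabs; lra].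
unfold qabs; rewrite Rsqr_sqrt by apply qnormsq_ge_0.
unfold Rsqr.
replace ((sqrt (qnormsq p) + sqrt (qnormsq q)) * (sqrt (qnormsq p) + sqrt (qnormsq q)))
  with (sqrt (qnormsq p) * sqrt (qnormsq p) + sqrt (qnormsq q) * sqrt (qnormsq q)
        + 2 * (sqrt (qnormsq p) * sqrt (qnormsq q))) by ring.
rewrite !sqrt_sqrt by apply qnormsq_ge_0.
rewrite <- sqrt_mult by apply qnormsq_ge_0.
destruct p as [[[a b] c] d], q as [[[a' b'] c'] d'].
assert (a * a' + b * b' + c * c' + d * d'
        <= sqrt (qnormsq (a, b, c, d) * qnormsq (a', b', c', d'))).
{ apply Rle_trans with (1 := Rle_abs _).
  rewrite <- sqrt_Rsqr_abs; apply sqrt_le_1_alt.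
  unfold Rsqr; simpl.
  pose proof (pow2_ge_0 (a * b' - b * a')); pose proof (pow2_ge_0 (a * c' - c * a')).
  pose proof (pow2_ge_0 (a * d' - d * a')); pose proof (pow2_ge_0 (b * c' - c * b')).
  pose proof (pow2_ge_0 (b * d' - d * b')); pose proof (pow2_ge_0 (c * d' - d * c')).
  lra. }
simpl in *; lra.
Qed.

Lemma qabs_scal (x : R) (q : quat) : qabs (qscal x q) <= Rabs x * qabs q.
Proof.
unfold qabs; rewrite <- sqrt_Rsqr_abs, <- sqrt_mult_alt by apply Rle_0_sqr.
apply Req_le; f_equal; destruct q as [[[a b] c] d]; unfold Rsqr; simpl; ring.
Qed.

Lemma Rabs_le_qabs (a b c d : R) :
  Rabs a <= qabs (a, b, c, d) /\ Rabs b <= qabs (a, b, c, d) /\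
  Rabs c <= qabs (a, b, c, d) /\ Rabs d <= qabs (a, b, c, d).
Proof.
unfold qabs; rewrite <- !sqrt_Rsqr_abs.
repeat split; apply sqrt_le_1_alt; unfold Rsqr; simpl; nra.
Qed.

Lemma qabs_ball1 (p q : quat) (eps : R) :
  qabs (minus q p) < eps -> ball p eps q.
Proof.
destruct p as [[[a b] c] d], q as [[[a' b'] c'] d']; intros H.
destruct (Rabs_le_qabs (a' - a) (b' - b) (c' - c) (d' - d)) as (H1 & H2 & H3 & H4).
change (qabs (a' - a, b' - b, c' - c, d' - d) < eps) in H.
repeat split; eapply Rle_lt_trans; eassumption.
Qed.

Lemma qabs_ball2 (p q : quat) (eps : posreal) :
  ball p eps q -> qabs (minus q p) < 2 * eps.
Proof.
destruct p as [[[a b] c] d], q as [[[a' b'] c'] d'].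
intros [[[H1 H2] H3] H4]; simpl in H1, H2, H3, H4.
change (qabs (a' - a, b' - b, c' - c, d' - d) < 2 * eps).
change (Rabs (a' - a) < eps) in H1; change (Rabs (b' - b) < eps) in H2.
change (Rabs (c' - c) < eps) in H3; change (Rabs (d' - d) < eps) in H4.
assert (He := cond_pos eps).
unfold qabs; rewrite <- (sqrt_pow2 (2 * eps)) by lra.
apply sqrt_lt_1_alt; split; [apply qnormsq_ge_0|simpl].
apply Rabs_def2 in H1; apply Rabs_def2 in H2.
apply Rabs_def2 in H3; apply Rabs_def2 in H4.
assert (forall t, - eps < t /\ t < eps -> t * t < eps * eps) as Hsq
  by (intros t [? ?]; nra).
assert (K1 := Hsq (a' - a) (conj (proj2 H1) (proj1 H1))).
assert (K2 := Hsq (b' - b) (conj (proj2 H2) (proj1 H2))).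
assert (K3 := Hsq (c' - c) (conj (proj2 H3) (proj1 H3))).
assert (K4 := Hsq (d' - d) (conj (proj2 H4) (proj1 H4))).
lra.
Qed.

Lemma qabs_eq_0 (q : quat) : qabs q = 0 -> q = zero.
Proof.
intros H; apply sqrt_eq_0 in H; [|apply qnormsq_ge_0].
destruct q as [[[a b] c] d]; simpl in H; apply quat_ext; nra.
Qed.

Definition quat_NormedModule_mixin :
    NormedModule.mixin_of R_AbsRing quat_NormedModuleAux :=
  NormedModule.Mixin R_AbsRing quat_NormedModuleAux qabs 2
    qabs_triangle qabs_scal qabs_ball1 qabs_ball2 qabs_eq_0.

Canonical quat_NormedModule : NormedModule R_AbsRing :=
  NormedModule.Pack R_AbsRing quat
    (NormedModule.Class R_AbsRing quat quat_NormedModuleAux_class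
       quat_NormedModule_mixin) quat.

Definition qre (q : quat) : R := let '(a, _, _, _) := q in a.

Definition qim (q : quat) : quat := let '(_, b, c, d) := q in (0, b, c, d).

Definition qconj (q : quat) : quat := let '(a, b, c, d) := q in (a, - b, - c, - d).

Definition qinv (q : quat) : quat := scal (/ qnormsq q) (qconj q).

Definition qpowZ (q : quat) (n : Z) : quat :=
  match n with
  | Z0 => one
  | Zpos k => pow_n q (Pos.to_nat k)
  | Zneg k => pow_n (qinv q) (Pos.to_nat k)
  end.

(** * Slices and spheres *)

Definition imag_unit (I : quat) : Prop := mult I I = opp one.

(* [x + I y] *)
Definition slice_pt (I : quat) (x y : R) : quat := plus (quat_of_R x) (scal y I).

(* [x + y S] *)
Definition sphere (x y : R) (q : quat) : Prop :=
  exists J, imag_unit J /\ q = slice_pt J x y.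

(* [R + I R] *)
Definition line (I q : quat) : Prop := exists x y, q = slice_pt I x y.

Definition same_line (q p : quat) : Prop :=
  exists I, imag_unit I /\ line I q /\ line I p.

(* [Omega_I], read in the coordinates [(x, y)] of [R + I R]. *)
Definition slice (Omega : quat -> Prop) (I : quat) (z : R * R) : Prop :=
  Omega (slice_pt I (fst z) (snd z)).

Definition symmetric (Omega : quat -> Prop) : Prop :=
  forall (I : quat) (x y : R), imag_unit I -> Omega (slice_pt I x y) ->
  forall q, sphere x y q -> Omega q.

Definition connected {T : UniformSpace} (A : T -> Prop) : Prop :=
  forall U V : T -> Prop, open U -> open V ->
  (forall t, A t -> U t \/ V t) ->
  (exists t, A t /\ U t) -> (exists t, A t /\ V t) ->
  exists t, A t /\ U t /\ V t.

Definition domain {T : UniformSpace} (A : T -> Prop) : Prop :=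
  open A /\ connected A.

Definition slice_domain (Omega : quat -> Prop) : Prop :=
  domain Omega /\
  (exists x : R, Omega (quat_of_R x)) /\
  (forall I, imag_unit I -> domain (slice Omega I)).

(** * Regular functions *)

(* A function on [Omega] is a total function whose values outside [Omega] are
   irrelevant; [Omega] is meant to be open. *)
Definition regular (Omega : quat -> Prop) (f : quat -> quat) : Prop :=
  forall I, imag_unit I ->
  exists fx fy : R * R -> quat,
  forall x y : R, slice Omega I (x, y) ->
    is_derive (fun t : R => f (slice_pt I t y)) x (fx (x, y)) /\
    is_derive (fun t : R => f (slice_pt I x t)) y (fy (x, y)) /\
    continuous fx (x, y) /\
    continuous fy (x, y) /\
    scal (1 / 2) (plus (fx (x, y)) (mult I (fy (x, y)))) = zero.

(* The domain of [(q - p)^{*n}]. *)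
Definition star_pow_dom (p : quat) (n : Z) (q : quat) : Prop :=
  (0 <= n)%Z \/ ~ sphere (qre p) (qabs (qim p)) q.

(* [g] is [(q - p)^{*n}].  For real [p] every [q] is on a common line with
   [p], so that [g q] is then [(q - p)^n] everywhere. *)
Definition is_star_pow (p : quat) (n : Z) (g : quat -> quat) : Prop :=
  regular (star_pow_dom p n) g /\
  forall q, star_pow_dom p n q -> same_line q p -> g q = qpowZ (minus q p) n.

(** * Singularities *)

Definition sigma (q p : quat) : R :=
  if excluded_middle_informative (same_line q p) then qabs (minus q p)
  else sqrt ((qre q - qre p) ^ 2 + (qabs (qim q) + qabs (qim p)) ^ 2).

Definition tau (q p : quat) : R :=
  if excluded_middle_informative (same_line q p) then qabs (minus q p)
  else sqrt ((qre q - qre p) ^ 2 + (qabs (qim q) - qabs (qim p)) ^ 2).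

(* [Sigma(p, 0, r)] *)
Definition Sigma0 (p : quat) (r : R) (q : quat) : Prop :=
  0 < tau q p /\ sigma q p < r.

Definition is_Zseries (u : Z -> quat) (s : quat) : Prop :=
  exists s1 s2 : quat,
    is_series (fun n : nat => u (Z.of_nat n)) s1 /\
    is_series (fun n : nat => u (- Z.of_nat (S n))%Z) s2 /\
    s = plus s1 s2.

Definition singularity (Omega' : quat -> Prop) (p : quat) : Prop :=
  exists r : R, 0 < r /\ forall q, Sigma0 p r q -> Omega' q.

(* [p] is a singularity for [f], regular on [Omega'], and
   [f q = sum_n (q - p)^{*n} a_n] on some [Sigma(p, 0, r)] included in
   [Omega'].  The coefficients do not depend on [r]. *)
Definition is_Laurent (Omega' : quat -> Prop) (f : quat -> quat) (p : quat)
    (a : Z -> quat) : Prop :=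
  exists r : R, 0 < r /\ (forall q, Sigma0 p r q -> Omega' q) /\
  exists E : Z -> quat -> quat,
    (forall n, is_star_pow p n (E n)) /\
    (forall q, Sigma0 p r q -> is_Zseries (fun n => mult (E n q) (a n)) (f q)).

Definition vanishes_below (a : Z -> quat) (m : nat) : Prop :=
  forall k : nat, (m < k)%nat -> a (- Z.of_nat k)%Z = zero.

Definition pole (Omega' : quat -> Prop) (f : quat -> quat) (p : quat) : Prop :=
  exists a, is_Laurent Omega' f p a /\ exists m, vanishes_below a m.

(* [p] is a pole and [ord_f(p) = m]. *)
Definition is_ord (Omega' : quat -> Prop) (f : quat -> quat) (p : quat)
    (m : nat) : Prop :=
  exists a, is_Laurent Omega' f p a /\ vanishes_below a m /\
    forall m' : nat, vanishes_below a m' -> (m <= m')%nat.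

Definition removable (Omega' : quat -> Prop) (f : quat -> quat) (p : quat) : Prop :=
  singularity Omega' p /\
  exists (U : quat -> Prop) (g : quat -> quat),
    open U /\ U p /\ regular U g /\ (forall q, U q -> Omega' q -> g q = f q).

(* [f] is semiregular in [Omega], where [Omega'], the set on which [f] is
   given as a regular function, is part of the data of [f]. *)
Definition semiregular (Omega Omega' : quat -> Prop) (f : quat -> quat) : Prop :=
  (forall q, Omega' q -> Omega q) /\
  symmetric Omega' /\ slice_domain Omega' /\ regular Omega' f /\
  (forall q, Omega q -> ~ Omega' q -> pole Omega' f q \/ removable Omega' f q).

(* Main.v *)
Require Import Defs.
From Stdlib Require Import Reals ZArith Lra Lia ClassicalEpsilon.
From Coquelicot Require Import Coquelicot.

Open Scope R_scope.

(** On each slice a regular function is holomorphic, hence a convergent power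
    series near every point (Cauchy's formula), so every point of [Omega] is a
    pole and nonzero functions on a slice domain cannot vanish on a real
    interval.  The identity principle gives the representation formula: [f] at
    [x + J y] is [A f (x + I y) + B f (x - I y)] with [A = (1 - J I) / 2] and
    [B = (1 + J I) / 2].  As [J A = A I] and [J B = - B I], the Laurent
    coefficients at [x + J y] are [A a_n + B a'_n], where [a_n] and [a'_n] are
    those at [x + I y] and [x - I y].  This is [alpha_n + J beta_n] with [alpha_n]
    and [beta_n] independent of [J], so the lowest nonzero pair
    [(alpha_n, beta_n)] with [n < 0] yields a vanishing coefficient for at most one
    [J]. *)

(** An order is witnessed by exhibiting one expansion, so the proof builds an expansion at every
    point of the sphere out of two reference ones. For nonreal [p], a radius at most [|Im p|]
    confines [Sigma0] to a punctured disc of the slice through [p], where star powers are ordinary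
    powers. The second reference point is written [emb (opp I) z0], so that both series have the
    same complex centre [z0] and the same powers [(z - z0)^n], embedded along [I] and [- I]; [A] and
    [B] carry both embeddings to the slice of [J]. The reference points may themselves be regular or
    removable for [f], hence the need for an expansion at every point of [Omega]. If
    [alpha_n + J beta_n] vanishes for two distinct [J], then [beta_n = 0] because the quaternions
    have no zero divisors, and then [alpha_n = 0]. To reach quaternion-valued functions from real
    analysis, each real coordinate of [h] is paired with the same coordinate of [- I h]: the pair
    solves an ordinary Cauchy-Riemann system. *)

Lemma continuous_pair {T A B : UniformSpace} (f : T -> A) (g : T -> B) (t : T) :
  continuous f t -> continuous g t -> continuous (fun u => (f u, g u)) t.
Proof.
intros Hf Hg P [eps HP].
specialize (Hf _ (locally_ball (f t) eps)); specialize (Hg _ (locally_ball (g t) eps)).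
unfold filtermap in *; generalize (filter_and _ _ Hf Hg); apply filter_imp.
intros u [H1 H2]; apply HP; split; assumption.
Qed.

(** Differentiability of [U] at the point only takes the first partial derivative near it,
    continuous there, and the second one at the point itself. *)
Lemma is_derive_comp_pair (U : R * R -> R) (Ux : R * R -> R) (Uy : R)
    (g1 g2 : R -> R) (t d1 d2 : R) :
  locally (g1 t, g2 t) (fun z : R * R =>
    is_derive (fun u => U (u, snd z)) (fst z) (Ux z)) ->
  is_derive (fun v => U (g1 t, v)) (g2 t) Uy ->
  continuous Ux (g1 t, g2 t) ->
  is_derive g1 t d1 -> is_derive g2 t d2 ->
  is_derive (fun s => U (g1 s, g2 s)) t (d1 * Ux (g1 t, g2 t) + d2 * Uy).
Proof.
intros H1 H2 H3 Hg1 Hg2.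
assert (H := is_derive_filterdiff (fun x y => U (x, y)) (g1 t) (g2 t)
  (fun x y => Ux (x, y)) Uy).
assert (HU : filterdiff (fun u : R * R => U (fst u, snd u)) (locally (g1 t, g2 t))
  (fun u : R * R => plus (scal (fst u) (Ux (g1 t, g2 t))) (scal (snd u) Uy))).
{ apply H.
  - revert H1; apply filter_imp; intros [a b]; simpl; auto.
  - exact H2.
  - apply continuous_ext with (2 := H3); intros [a b]; reflexivity. }
assert (HC := filterdiff_comp'_2 g1 g2 (fun x y => U (x, y)) t _ _
  (fun x y => plus (scal x (Ux (g1 t, g2 t))) (scal y Uy)) Hg1 Hg2 HU).
apply filterdiff_ext_lin with (1 := HC).
intros y; simpl; unfold plus, scal, mult; simpl; unfold mult; simpl; ring.
Qed.

(** * Power series of holomorphic functions *)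

Definition zeta (r th : R) : C := (r * cos th, r * sin th).

Lemma Cmod_zeta r th : 0 < r -> Cmod (zeta r th) = r.
Proof.
intros Hr; unfold Cmod, zeta; simpl fst; simpl snd.
replace ((r * cos th) ^ 2 + (r * sin th) ^ 2) with (r ^ 2).
- apply sqrt_pow2; lra.
- assert (H := sin2_cos2 th); unfold Rsqr in H; simpl.
  replace (r * cos th * (r * cos th * 1) + r * sin th * (r * sin th * 1)) with
    (r * r * (sin th * sin th + cos th * cos th)) by ring.
  rewrite H; ring.
Qed.

(* Cauchy-Riemann system for [U + i V] with [p + i q] its derivative. *)
Definition CR_at (U V p q : R * R -> R) (x y : R) : Prop :=
  is_derive (fun t => U (t, y)) x (p (x, y)) /\
  is_derive (fun t => U (x, t)) y (- q (x, y)) /\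
  is_derive (fun t => V (t, y)) x (q (x, y)) /\
  is_derive (fun t => V (x, t)) y (p (x, y)) /\
  continuous p (x, y) /\ continuous q (x, y).

Lemma Cmod_lt_locally (r : R) (z : R * R) :
  Cmod z < r -> locally z (fun w : R * R => Cmod w < r).
Proof.
intros H.
(* Balls are products of intervals, and [Cmod] is at most the sum of the two coordinate moduli;
   hence half the margin. *)
assert (He : 0 < (r - Cmod z) / 2) by lra.
exists (mkposreal _ He); intros w [H1 H2]; simpl in H1, H2.
change (Rabs (fst w - fst z) < (r - Cmod z) / 2) in H1.
change (Rabs (snd w - snd z) < (r - Cmod z) / 2) in H2.
replace w with (Cplus z (Cminus w z)) by (apply injective_projections; simpl; ring).
apply Rle_lt_trans with (1 := Cmod_triangle _ _).
assert (HT : Cmod (Cminus w z) <= Rabs (fst w - fst z) + Rabs (snd w - snd z)).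
{ replace (Cminus w z) with
    (Cplus (fst w - fst z, 0) (0, snd w - snd z)) by (apply injective_projections; simpl; ring).
  apply Rle_trans with (1 := Cmod_triangle _ _).
  apply Req_le; f_equal; unfold Cmod; simpl fst; simpl snd.
  - rewrite <- sqrt_Rsqr_abs; f_equal; unfold Rsqr; ring.
  - rewrite <- sqrt_Rsqr_abs; f_equal; unfold Rsqr; ring. }
lra.
Qed.

(** This is [(F o g)' = g' F'(g)] for [F = U + i V], with [g' = d1 + i d2] and [F' = p + i q]. *)
Lemma CR_chain (U V p q : R * R -> R) (r0 : R) (g1 g2 : R -> R) (t d1 d2 : R) :
  (forall x y, Cmod (x, y) < r0 -> CR_at U V p q x y) ->
  Cmod (g1 t, g2 t) < r0 -> is_derive g1 t d1 -> is_derive g2 t d2 ->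
  is_derive (fun s => U (g1 s, g2 s)) t (d1 * p (g1 t, g2 t) - d2 * q (g1 t, g2 t)) /\
  is_derive (fun s => V (g1 s, g2 s)) t (d1 * q (g1 t, g2 t) + d2 * p (g1 t, g2 t)).
Proof.
intros H Ht Hg1 Hg2.
destruct (H _ _ Ht) as (A1 & A2 & A3 & A4 & A5 & A6).
split.
- replace (d1 * p (g1 t, g2 t) - d2 * q (g1 t, g2 t)) with
    (d1 * p (g1 t, g2 t) + d2 * - q (g1 t, g2 t)) by ring.
  apply is_derive_comp_pair; auto.
  generalize (Cmod_lt_locally _ _ Ht); apply filter_imp.
  intros [a b] Hab; exact (proj1 (H a b Hab)).
- apply is_derive_comp_pair; auto.
  generalize (Cmod_lt_locally _ _ Ht); apply filter_imp.
  intros [a b] Hab; exact (proj1 (proj2 (proj2 (H a b Hab)))).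
Qed.

Lemma continuous_fst' {A B : UniformSpace} (z : A * B) : continuous fst z.
Proof. destruct z; apply continuous_fst. Qed.

Lemma continuous_snd' {A B : UniformSpace} (z : A * B) : continuous snd z.
Proof. destruct z; apply continuous_snd. Qed.

Lemma continuous_Rmult {T : UniformSpace} (f g : T -> R) (t : T) :
  continuous f t -> continuous g t -> continuous (fun u => f u * g u) t.
Proof. exact (continuous_mult (K := R_AbsRing) f g t). Qed.

Lemma continuous_Rplus {T : UniformSpace} (f g : T -> R) (t : T) :
  continuous f t -> continuous g t -> continuous (fun u => f u + g u) t.
Proof. exact (continuous_plus (V := R_NormedModule) f g t). Qed.

Lemma continuous_Rminus {T : UniformSpace} (f g : T -> R) (t : T) :
  continuous f t -> continuous g t -> continuous (fun u => f u - g u) t.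
Proof. exact (continuous_minus (V := R_NormedModule) f g t). Qed.

Lemma continuous_Ropp {T : UniformSpace} (f : T -> R) (t : T) :
  continuous f t -> continuous (fun u => - f u) t.
Proof. exact (continuous_opp (V := R_NormedModule) f t). Qed.

Lemma continuous_Rsin {T : UniformSpace} (f : T -> R) (t : T) :
  continuous f t -> continuous (fun u => sin (f u)) t.
Proof. intros H; apply (continuous_comp f sin); [exact H | apply continuity_pt_filterlim, continuity_sin]. Qed.

Lemma continuous_Rcos {T : UniformSpace} (f : T -> R) (t : T) :
  continuous f t -> continuous (fun u => cos (f u)) t.
Proof. intros H; apply (continuous_comp f cos); [exact H | apply continuity_pt_filterlim, continuity_cos]. Qed.

Ltac cont :=
  lazymatch goal with
  | |- continuous fst _ => apply continuous_fst'
  | |- continuous snd _ => apply continuous_snd'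
  | |- continuous (fun u => u) _ => apply continuous_id
  | |- continuous (fun u => _ + _) _ => apply continuous_Rplus; cont
  | |- continuous (fun u => _ - _) _ => apply continuous_Rminus; cont
  | |- continuous (fun u => - _) _ => apply continuous_Ropp; cont
  | |- continuous (fun u => _ * _) _ => apply continuous_Rmult; cont
  | |- continuous (Rmult _) _ => apply continuous_Rmult; cont
  | |- continuous sin _ => apply (continuous_Rsin (fun u => u)), continuous_id
  | |- continuous cos _ => apply (continuous_Rcos (fun u => u)), continuous_id
  | |- continuous (fun u => sin _) _ => apply continuous_Rsin; cont
  | |- continuous (fun u => cos _) _ => apply continuous_Rcos; cont
  | |- _ => first [solve [auto] | apply continuous_const | idtac]
  end.

Lemma continuous_ex_RInt (f : R -> R) (a b : R) :
  (forall t, continuous f t) -> ex_RInt f a b.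
Proof. intros H; apply (ex_RInt_continuous (V := R_CompleteNormedModule)); auto. Qed.

(** The point is [(1 - t) z + t zeta], and [|1 - t| + |t|] is at most [1 + 2 e] when [t] leaves
    [[0, 1]] by at most [e]. *)
Lemma Cmod_segment_lt (a b r r0 e t th : R) :
  0 < r -> Cmod (a, b) < r -> 0 <= e -> (1 + 2 * e) * r < r0 -> - e <= t <= 1 + e ->
  Cmod (a + t * (r * cos th - a), b + t * (r * sin th - b)) < r0.
Proof.
intros Hr Hz He Hr0 Ht.
replace (a + t * (r * cos th - a), b + t * (r * sin th - b)) with
  (Cplus (Cmult (RtoC (1 - t)) (a, b)) (Cmult (RtoC t) (zeta r th)))
  by (apply injective_projections; simpl; ring).
apply Rle_lt_trans with (1 := Cmod_triangle _ _).
rewrite !Cmod_mult, !Cmod_R, Cmod_zeta by assumption.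
apply Rle_lt_trans with ((Rabs (1 - t) + Rabs t) * r).
- rewrite Rmult_plus_distr_r; apply Rplus_le_compat_r, Rmult_le_compat_l; [apply Rabs_pos | lra].
- apply Rle_lt_trans with (2 := Hr0), Rmult_le_compat_r; [lra|].
  unfold Rabs; destruct (Rcase_abs (1 - t)), (Rcase_abs t); lra.
Qed.

(* Cauchy's formula by contracting the circle [zeta = r e^{i th}] to
   [z = (a, b)]: [phi t] is the real part of [w F(z + t (zeta - z))] with
   [w = zeta / (zeta - z)], and [t] times its derivative in [t] is a derivative
   in [th], so that its integral over the circle does not depend on [t]. *)
Section Cauchy.

Variables (U V p q : R * R -> R) (r0 r a b : R) (w1 w2 : R -> R).
Hypothesis Hr : 0 < r < r0.
Hypothesis Hz : Cmod (a, b) < r.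
Hypothesis HCR : forall x y, Cmod (x, y) < r0 -> CR_at U V p q x y.
Hypothesis Hw1 : forall th, continuous w1 th.
Hypothesis Hw2 : forall th, continuous w2 th.
Hypothesis Hw3 : forall th,
  w1 th * (r * cos th - a) - w2 th * (r * sin th - b) = r * cos th.
Hypothesis Hw4 : forall th,
  w1 th * (r * sin th - b) + w2 th * (r * cos th - a) = r * sin th.

Let g (t th : R) : R * R := (a + t * (r * cos th - a), b + t * (r * sin th - b)).
Let phi (t th : R) : R := w1 th * U (g t th) - w2 th * V (g t th).
(** The real part of [zeta F'(g)]. It is the derivative of [phi] in [t], because
    [w (zeta - z) = zeta]. *)
Let psi (t th : R) : R := r * cos th * p (g t th) - r * sin th * q (g t th).

(** Derivatives in [t] at the ends [0] and [1] are two-sided, so [t] must be allowed slightly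
    outside [[0, 1]] while the segment stays in the disc of radius [r0]. *)
Let small (e : R) := 0 < e /\ (1 + 2 * e) * r < r0.

Lemma small_margin_exists : exists e, small e.
Proof.
exists ((r0 - r) / (4 * r)); split.
- apply Rdiv_lt_0_compat; lra.
- replace ((1 + 2 * ((r0 - r) / (4 * r))) * r) with (r + (r0 - r) / 2) by (field; lra); lra.
Qed.

Lemma segment_in_disc e t th : small e -> - e <= t <= 1 + e -> Cmod (g t th) < r0.
Proof. intros [H1 H2] Ht; apply Cmod_segment_lt with e; lra. Qed.

Lemma segment_continuous (z : R * R) : continuous (fun z : R * R => g (fst z) (snd z)) z.
Proof. apply continuous_pair; cont. Qed.

Lemma integrand_derive e t th : small e -> - e <= t <= 1 + e ->
  is_derive (fun s => phi s th) t (psi t th).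
Proof.
intros He Ht.
assert (Hg := segment_in_disc e t th He Ht).
destruct (CR_chain U V p q r0 (fun s => a + s * (r * cos th - a))
  (fun s => b + s * (r * sin th - b)) t (r * cos th - a) (r * sin th - b) HCR Hg)
  as [H1 H2]; try (auto_derive; [trivial | ring]).
fold (g t th) in H1, H2.
unfold phi.
evar_last.
- apply @is_derive_minus; apply is_derive_scal; [exact H1 | exact H2].
- unfold minus, plus, opp; simpl.
  change (a + t * (r * cos th - a), b + t * (r * sin th - b)) with (g t th).
  transitivity (p (g t th) * (w1 th * (r * cos th - a) - w2 th * (r * sin th - b))
    - q (g t th) * (w1 th * (r * sin th - b) + w2 th * (r * cos th - a))); [ring|].
  rewrite Hw3, Hw4; unfold psi; ring.
Qed.


(** Turning the angle moves [g t th] with velocity [t i zeta], so [F(g)] has derivative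
    [t i zeta F'(g)], whose imaginary part is [t psi]. *)
Lemma segment_derive_angle e t th : small e -> - e <= t <= 1 + e ->
  is_derive (fun s => U (g t s)) th
    (- t * (r * sin th * p (g t th) + r * cos th * q (g t th))) /\
  is_derive (fun s => V (g t s)) th (t * psi t th).
Proof.
intros He Ht.
assert (Hg := segment_in_disc e t th He Ht).
destruct (CR_chain U V p q r0 (fun s => a + t * (r * cos s - a))
  (fun s => b + t * (r * sin s - b)) th (- t * (r * sin th)) (t * (r * cos th)) HCR Hg)
  as [H1 H2]; try (auto_derive; [trivial | ring]).
fold (g t th) in H1, H2; split.
- evar_last; [exact H1 | ring].
- evar_last; [exact H2 | unfold psi; ring].
Qed.

Lemma integrand_continuous e t th : small e -> - e <= t <= 1 + e -> continuous (phi t) th.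
Proof.
intros He Ht; destruct (segment_derive_angle e t th He Ht) as [H1 H2].
unfold phi; cont; auto.
- apply (ex_derive_continuous (V := R_NormedModule)); eexists; exact H1.
- apply (ex_derive_continuous (V := R_NormedModule)); eexists; exact H2.
Qed.

Lemma dintegrand_continuous_2d e t th : small e -> - e <= t <= 1 + e ->
  continuous (fun z : R * R => psi (fst z) (snd z)) (t, th).
Proof.
intros He Ht.
assert (Hg := segment_in_disc e t th He Ht).
destruct (HCR _ _ Hg) as (_ & _ & _ & _ & A5 & A6).
unfold psi; cont.
- apply (continuous_comp (fun z : R * R => g (fst z) (snd z)) p); [apply segment_continuous | exact A5].
- apply (continuous_comp (fun z : R * R => g (fst z) (snd z)) q); [apply segment_continuous | exact A6].
Qed.

Lemma dintegrand_continuous e t th : small e -> - e <= t <= 1 + e -> continuous (psi t) th.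
Proof.
intros He Ht.
apply (continuous_comp (fun s => (t, s)) (fun z : R * R => psi (fst z) (snd z))).
- apply continuous_pair; cont.
- apply (dintegrand_continuous_2d e); assumption.
Qed.

(** For [t <> 0], [t psi t] is the derivative of the periodic function [V (g t th)], and [t] can be
    divided out. At [t = 0] the point [g] is constant and [psi] is a combination of [cos] and [sin],
    with an explicit periodic primitive. *)
Lemma RInt_dintegrand e t : small e -> - e <= t <= 1 + e -> RInt (psi t) 0 (2 * PI) = 0.
Proof.
intros He Ht.
destruct (Req_dec t 0) as [->|Hn].
- apply (is_RInt_unique (V := R_CompleteNormedModule)).
  evar_last.
  + apply (is_RInt_derive (V := R_CompleteNormedModule)
      (fun th => r * sin th * p (a, b) + r * cos th * q (a, b))).
    * intros th _; auto_derive; [trivial|].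
      unfold psi, g; rewrite !Rmult_0_l, !Rplus_0_r; ring.
    * intros th _; apply (dintegrand_continuous e); assumption.
  + rewrite sin_2PI, cos_2PI, sin_0, cos_0; unfold minus, plus, opp; simpl; ring.
- assert (H : is_RInt (fun th => t * psi t th) 0 (2 * PI) 0).
  { evar_last.
    - apply (is_RInt_derive (V := R_CompleteNormedModule) (fun th => V (g t th))).
      + intros th _; apply (segment_derive_angle e); assumption.
      + intros th _; cont; apply (dintegrand_continuous e); assumption.
    - unfold g; rewrite sin_2PI, cos_2PI, sin_0, cos_0.
      unfold minus, plus, opp; simpl; ring. }
  apply (is_RInt_unique (V := R_CompleteNormedModule)) in H.
  assert (H2 : RInt (fun th => scal t (psi t th)) 0 (2 * PI) = scal t (RInt (psi t) 0 (2 * PI))).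
  { apply (RInt_scal (V := R_CompleteNormedModule)).
    apply continuous_ex_RInt; intros th; apply (dintegrand_continuous e); assumption. }
  unfold scal in H2; simpl in H2; unfold mult in H2; simpl in H2.
  rewrite H2 in H; apply Rmult_integral in H; tauto.
Qed.

Lemma RInt_integrand_derive e t : small e -> 0 <= t <= 1 ->
  is_derive (fun s => RInt (phi s) 0 (2 * PI)) t 0.
Proof.
intros He Ht; assert (Hep : 0 < e) by apply He.
assert (HL : locally t (fun s => - e <= s <= 1 + e)).
{ exists (mkposreal e Hep); intros s Hs.
  change (Rabs (s - t) < e) in Hs; apply Rabs_def2 in Hs; lra. }
evar_last.
- apply is_derive_RInt_param.
  + revert HL; apply filter_imp; intros s Hs th _.
    eexists; apply (integrand_derive e); assumption.
  + intros th _.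
    apply continuity_2d_pt_ext_loc with psi.
    * exists (mkposreal e Hep); intros u v Hu _; simpl in Hu.
      symmetry; apply is_derive_unique, (integrand_derive e); [assumption|].
      apply Rabs_def2 in Hu; lra.
    * apply continuity_2d_pt_filterlim, (dintegrand_continuous_2d e); [assumption | lra].
  + revert HL; apply filter_imp; intros s Hs.
    apply continuous_ex_RInt; intros th; apply (integrand_continuous e); assumption.
- transitivity (RInt (psi t) 0 (2 * PI)); [|apply (RInt_dintegrand e); [assumption | lra]].
  apply RInt_ext; intros th _; apply is_derive_unique, (integrand_derive e); [assumption | lra].
Qed.

(** The two sides are the integrals of [phi 1] and [phi 0]. The integrals of [w1] and [w2] are left
    as they are; they are evaluated later by expanding the kernel against constant functions. *)
Lemma Cauchy_kernel :
  RInt (fun th => w1 th * U (zeta r th) - w2 th * V (zeta r th)) 0 (2 * PI) =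
  U (a, b) * RInt w1 0 (2 * PI) - V (a, b) * RInt w2 0 (2 * PI).
Proof.
destruct small_margin_exists as [e He].
assert (H : RInt (phi 0) 0 (2 * PI) = RInt (phi 1) 0 (2 * PI)).
{ apply (eq_is_derive (fun s => RInt (phi s) 0 (2 * PI)) 0 1); [|lra].
  intros t Ht; apply (RInt_integrand_derive e); assumption. }
transitivity (RInt (phi 1) 0 (2 * PI)).
- apply RInt_ext; intros th _; unfold phi, g, zeta.
  replace (a + 1 * (r * cos th - a)) with (r * cos th) by ring.
  replace (b + 1 * (r * sin th - b)) with (r * sin th) by ring.
  reflexivity.
- rewrite <- H.
  transitivity (RInt (fun th => minus (scal (U (a, b)) (w1 th)) (scal (V (a, b)) (w2 th))) 0 (2 * PI)).
  + apply RInt_ext; intros th _; unfold phi, g.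
    rewrite !Rmult_0_l, !Rplus_0_r.
    unfold minus, plus, opp, scal; simpl; unfold mult; simpl; ring.
  + assert (HI : forall c (w : R -> R), (forall th, continuous w th) ->
      is_RInt (fun th => scal c (w th)) 0 (2 * PI) (c * RInt w 0 (2 * PI))).
    { intros c w Hw; apply (is_RInt_scal (V := R_NormedModule)).
      apply (RInt_correct (V := R_CompleteNormedModule)), continuous_ex_RInt, Hw. }
    apply (is_RInt_unique (V := R_CompleteNormedModule)).
    apply (is_RInt_minus (V := R_NormedModule)); apply HI; assumption.
Qed.

End Cauchy.

(** De Moivre's formula for [1 / zeta]. *)
Lemma Cpow_polar (r th : R) (n : nat) :
  Cpow (/ r * cos th, - (/ r * sin th)) n =
  ((/ r) ^ n * cos (INR n * th), - ((/ r) ^ n * sin (INR n * th))).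
Proof.
induction n as [|n IH].
- simpl; rewrite Rmult_0_l, cos_0, sin_0; apply injective_projections; simpl; ring.
- rewrite Cpow_S, IH, S_INR.
  replace ((INR n + 1) * th) with (th + INR n * th) by ring.
  rewrite cos_plus, sin_plus; apply injective_projections; simpl; ring.
Qed.

Lemma Cmod_polar (r th : R) : 0 < r -> Cmod (/ r * cos th, - (/ r * sin th)) = / r.
Proof.
intros Hr; assert (0 < / r) by (apply Rinv_0_lt_compat, Hr).
rewrite <- (Cmod_zeta (/ r) th) at 3 by assumption.
unfold zeta, Cmod; simpl fst; simpl snd; f_equal; ring.
Qed.

(** With [fourier_im], the real and imaginary parts of the integral of [zeta^(-n) (G1 + i G2)] over
    the circle; the factor [1 / (2 pi)] is added where the Taylor coefficients are formed. *)
Definition fourier_re (r : R) (G1 G2 : R -> R) (n : nat) : R :=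
  (/ r) ^ n * RInt (fun th => cos (INR n * th) * G1 th + sin (INR n * th) * G2 th) 0 (2 * PI).

Definition fourier_im (r : R) (G1 G2 : R -> R) (n : nat) : R :=
  (/ r) ^ n * RInt (fun th => cos (INR n * th) * G2 th - sin (INR n * th) * G1 th) 0 (2 * PI).

(* [A n + i B n = (z / zeta)^n], and [e n] is the real part of
   [w (z / zeta)^n G] with [w = zeta / (zeta - z) = 1 + (z / zeta) w]. *)
Section Kernel_series.

Variables (r a b : R) (w1 w2 G1 G2 : R -> R).
Hypothesis Hr : 0 < r.
Hypothesis Hz : Cmod (a, b) < r.
Hypothesis Hw1 : forall th, continuous w1 th.
Hypothesis Hw2 : forall th, continuous w2 th.
Hypothesis HG1 : forall th, continuous G1 th.
Hypothesis HG2 : forall th, continuous G2 th.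
Hypothesis Hw3 : forall th,
  w1 th * (r * cos th - a) - w2 th * (r * sin th - b) = r * cos th.
Hypothesis Hw4 : forall th,
  w1 th * (r * sin th - b) + w2 th * (r * cos th - a) = r * sin th.

Let s (n : nat) : R := fst (Cpow (a, b) n).
Let t (n : nat) : R := snd (Cpow (a, b) n).
Let A (n : nat) (th : R) : R :=
  s n * ((/ r) ^ n * cos (INR n * th)) + t n * ((/ r) ^ n * sin (INR n * th)).
Let B (n : nat) (th : R) : R :=
  t n * ((/ r) ^ n * cos (INR n * th)) - s n * ((/ r) ^ n * sin (INR n * th)).
Let X (th : R) := w1 th * G1 th - w2 th * G2 th.
Let Y (th : R) := w2 th * G1 th + w1 th * G2 th.
Let e (n : nat) (th : R) : R := A n th * X th - B n th * Y th.

Lemma kernel_factor_pow n th :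
  (A n th, B n th) = Cpow (Cmult (a, b) (/ r * cos th, - (/ r * sin th))) n.
Proof.
rewrite Cpow_mult_l, Cpow_polar.
apply injective_projections; unfold A, B, s, t; simpl; ring.
Qed.

Lemma kernel_factor_bound n th : Rabs (A n th) <= (Cmod (a, b) / r) ^ n /\ Rabs (B n th) <= (Cmod (a, b) / r) ^ n.
Proof.
assert (H : Cmod (A n th, B n th) = (Cmod (a, b) / r) ^ n).
{ rewrite kernel_factor_pow, Cmod_pow, Cmod_mult, Cmod_polar by assumption; reflexivity. }
rewrite <- H.
assert (HM := Rmax_Cmod (A n th, B n th)); simpl in HM.
split; apply Rle_trans with (2 := HM); [apply Rmax_l | apply Rmax_r].
Qed.

Lemma kernel_term_continuous n th : continuous (e n) th.
Proof. unfold e, A, B, X, Y; cont. Qed.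

Lemma fourier_ex_RInt n :
  ex_RInt (fun th => cos (INR n * th) * G1 th + sin (INR n * th) * G2 th) 0 (2 * PI) /\
  ex_RInt (fun th => cos (INR n * th) * G2 th - sin (INR n * th) * G1 th) 0 (2 * PI).
Proof. split; apply continuous_ex_RInt; intros th; cont. Qed.

Lemma kernel_term_step n th : e n th =
  (s n * ((/ r) ^ n * (cos (INR n * th) * G1 th + sin (INR n * th) * G2 th))
   - t n * ((/ r) ^ n * (cos (INR n * th) * G2 th - sin (INR n * th) * G1 th)))
  + e (S n) th.
Proof.
assert (HS : (A (S n) th, B (S n) th) =
  Cmult (Cmult (a, b) (/ r * cos th, - (/ r * sin th))) (A n th, B n th)).
{ rewrite !kernel_factor_pow; apply Cpow_S. }
assert (Hsc : cos th * cos th + sin th * sin th = 1).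
{ generalize (sin2_cos2 th); unfold Rsqr; lra. }
(* [E1] and [E2] are the real and imaginary parts of [w = 1 + (z / zeta) w], where [z / zeta] has
   real part [(a cos th + b sin th) / r] and imaginary part [- (a sin th - b cos th) / r]. [EX] and
   [EY] are the same identity multiplied by [G1 + i G2]. *)
assert (E1 : w1 th = 1 + (w1 th * (a * cos th + b * sin th) + w2 th * (a * sin th - b * cos th)) / r).
{ apply Rmult_eq_reg_r with r; [|lra]; field_simplify; [|lra].
  generalize (f_equal (Rmult (cos th)) (Hw3 th)) (f_equal (Rmult (sin th)) (Hw4 th)); intros H3 H4.
  replace (w1 th * r) with (w1 th * r * (cos th * cos th + sin th * sin th)) by (rewrite Hsc; ring).
  replace r with (r * (cos th * cos th + sin th * sin th)) at 2 by (rewrite Hsc; ring).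
  lra. }
assert (E2 : w2 th = (w2 th * (a * cos th + b * sin th) - w1 th * (a * sin th - b * cos th)) / r).
{ apply Rmult_eq_reg_r with r; [|lra]; field_simplify; [|lra].
  generalize (f_equal (Rmult (sin th)) (Hw3 th)) (f_equal (Rmult (cos th)) (Hw4 th)); intros H3 H4.
  replace (w2 th * r) with (w2 th * r * (cos th * cos th + sin th * sin th)) by (rewrite Hsc; ring).
  lra. }
assert (HA := f_equal fst HS); assert (HB := f_equal snd HS); simpl in HA, HB.
assert (HA' : A (S n) th = (a * cos th + b * sin th) / r * A n th + (a * sin th - b * cos th) / r * B n th).
{ rewrite HA; field; lra. }
assert (HB' : B (S n) th = (a * cos th + b * sin th) / r * B n th - (a * sin th - b * cos th) / r * A n th).
{ rewrite HB; field; lra. }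
assert (EX : X th = G1 th + ((a * cos th + b * sin th) / r * X th + (a * sin th - b * cos th) / r * Y th)).
{ transitivity (
    (1 + (w1 th * (a * cos th + b * sin th) + w2 th * (a * sin th - b * cos th)) / r) * G1 th
    - (w2 th * (a * cos th + b * sin th) - w1 th * (a * sin th - b * cos th)) / r * G2 th);
    [rewrite <- E1, <- E2; reflexivity | unfold X, Y; field; lra]. }
assert (EY : Y th = G2 th + ((a * cos th + b * sin th) / r * Y th - (a * sin th - b * cos th) / r * X th)).
{ transitivity (
    (w2 th * (a * cos th + b * sin th) - w1 th * (a * sin th - b * cos th)) / r * G1 th
    + (1 + (w1 th * (a * cos th + b * sin th) + w2 th * (a * sin th - b * cos th)) / r) * G2 th);
    [rewrite <- E1, <- E2; reflexivity | unfold X, Y; field; lra]. }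
unfold e.
transitivity (A n th * (G1 th + ((a * cos th + b * sin th) / r * X th + (a * sin th - b * cos th) / r * Y th))
  - B n th * (G2 th + ((a * cos th + b * sin th) / r * Y th - (a * sin th - b * cos th) / r * X th)));
  [rewrite <- EX, <- EY; reflexivity|].
rewrite HA', HB'; unfold A, B; field; lra.
Qed.

Lemma RInt_kernel_term_step n :
  s n * fourier_re r G1 G2 n - t n * fourier_im r G1 G2 n =
  RInt (e n) 0 (2 * PI) - RInt (e (S n)) 0 (2 * PI).
Proof.
destruct (fourier_ex_RInt n) as [H1 H2].
apply (RInt_correct (V := R_CompleteNormedModule)) in H1.
apply (RInt_correct (V := R_CompleteNormedModule)) in H2.
assert (H : is_RInt (fun th => e n th - e (S n) th) 0 (2 * PI)
  (s n * fourier_re r G1 G2 n - t n * fourier_im r G1 G2 n)).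
{ apply (is_RInt_ext (V := R_NormedModule)) with (fun th =>
    minus (scal (s n * (/ r) ^ n) (cos (INR n * th) * G1 th + sin (INR n * th) * G2 th))
          (scal (t n * (/ r) ^ n) (cos (INR n * th) * G2 th - sin (INR n * th) * G1 th))).
  - intros th _; rewrite (kernel_term_step n).
    unfold minus, plus, opp, scal; simpl; unfold mult; simpl; ring.
  - evar_last.
    + apply (is_RInt_minus (V := R_NormedModule)); apply (is_RInt_scal (V := R_NormedModule));
        eassumption.
    + unfold fourier_re, fourier_im, minus, plus, opp, scal; simpl; unfold mult; simpl; ring. }
apply (is_RInt_unique (V := R_CompleteNormedModule)) in H; rewrite <- H.
apply (is_RInt_unique (V := R_CompleteNormedModule)).
apply (is_RInt_minus (V := R_NormedModule)); apply (RInt_correct (V := R_CompleteNormedModule));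
  apply continuous_ex_RInt, kernel_term_continuous.
Qed.

Lemma RInt_kernel_term_bound n :
  Rabs (RInt (e n) 0 (2 * PI)) <=
  (Cmod (a, b) / r) ^ n * RInt (fun th => Rabs (X th) + Rabs (Y th)) 0 (2 * PI).
Proof.
assert (HP := PI_RGT_0).
assert (HX : forall th, continuous (fun u => Rabs (X u) + Rabs (Y u)) th).
{ intros th; unfold X, Y; cont; apply (continuous_comp _ Rabs);
    [cont | apply continuous_Rabs | cont | apply continuous_Rabs]. }
apply Rle_trans with (RInt (fun th => Rabs (e n th)) 0 (2 * PI)).
- apply abs_RInt_le; [lra|]; apply continuous_ex_RInt, kernel_term_continuous.
- replace ((Cmod (a, b) / r) ^ n * RInt (fun th => Rabs (X th) + Rabs (Y th)) 0 (2 * PI)) with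
    (RInt (fun th => scal ((Cmod (a, b) / r) ^ n) (Rabs (X th) + Rabs (Y th))) 0 (2 * PI)).
  + apply RInt_le; [lra | | |].
    * apply continuous_ex_RInt; intros th; apply (continuous_comp _ Rabs);
        [apply kernel_term_continuous | apply continuous_Rabs].
    * apply (ex_RInt_scal (V := R_NormedModule)), continuous_ex_RInt, HX.
    * intros th _; unfold scal; simpl; unfold mult; simpl; unfold e.
      destruct (kernel_factor_bound n th) as [H1 H2].
      apply Rle_trans with (1 := Rabs_triang _ _).
      rewrite Rabs_Ropp, !Rabs_mult, Rmult_plus_distr_l.
      apply Rplus_le_compat; apply Rmult_le_compat_r; auto using Rabs_pos.
  + apply (is_RInt_unique (V := R_CompleteNormedModule)).
    apply (is_RInt_scal (V := R_NormedModule)), (RInt_correct (V := R_CompleteNormedModule)).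
    apply continuous_ex_RInt, HX.
Qed.

(** Each term is a difference of consecutive integrals of [e], so the partial sums telescope: [e 0]
    is the integrand of the limit, and the remainder, the integral of [e (S n)], is dominated by a
    geometric sequence of ratio [Cmod (a, b) / r < 1]. *)
Lemma kernel_series :
  is_series (fun n => s n * fourier_re r G1 G2 n - t n * fourier_im r G1 G2 n)
    (RInt (fun th => w1 th * G1 th - w2 th * G2 th) 0 (2 * PI)).
Proof.
assert (Hsum : forall n,
  sum_n (fun n => s n * fourier_re r G1 G2 n - t n * fourier_im r G1 G2 n) n =
  RInt (fun th => w1 th * G1 th - w2 th * G2 th) 0 (2 * PI) - RInt (e (S n)) 0 (2 * PI)).
{ induction n as [|n IH].
  - rewrite sum_O, RInt_kernel_term_step; f_equal.
    apply RInt_ext; intros th _; unfold e, A, B, s, t, X, Y; simpl.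
    rewrite Rmult_0_l, cos_0, sin_0; ring.
  - rewrite sum_Sn, IH, RInt_kernel_term_step; unfold plus; simpl; ring. }
assert (Hq : is_lim_seq (fun n => (Cmod (a, b) / r) ^ n) 0).
{ apply is_lim_seq_geom; rewrite Rabs_pos_eq.
  - apply Rmult_lt_reg_r with r; [assumption|]; field_simplify; lra.
  - apply Rmult_le_pos; [apply Cmod_ge_0 | left; apply Rinv_0_lt_compat, Hr]. }
set (K := RInt (fun th => Rabs (X th) + Rabs (Y th)) 0 (2 * PI)).
assert (HE : is_lim_seq (fun n => RInt (e n) 0 (2 * PI)) 0).
{ apply is_lim_seq_abs_0.
  apply is_lim_seq_le_le with (fun _ => 0) (fun n => (Cmod (a, b) / r) ^ n * K).
  - intros n; split; [apply Rabs_pos | apply RInt_kernel_term_bound].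
  - apply is_lim_seq_const.
  - replace (Finite 0) with (Rbar_mult 0 K) by (simpl; f_equal; ring).
    apply is_lim_seq_scal_r, Hq. }
apply is_lim_seq_incr_1 in HE.
change (is_lim_seq (sum_n (fun n => s n * fourier_re r G1 G2 n - t n * fourier_im r G1 G2 n))
  (RInt (fun th => w1 th * G1 th - w2 th * G2 th) 0 (2 * PI))).
apply is_lim_seq_ext with (fun n =>
  RInt (fun th => w1 th * G1 th - w2 th * G2 th) 0 (2 * PI) - RInt (e (S n)) 0 (2 * PI)).
- intros n; symmetry; apply Hsum.
- evar_last.
  + apply is_lim_seq_minus'; [apply is_lim_seq_const | exact HE].
  + f_equal; ring.
Qed.

End Kernel_series.

(** * Mean values on the circle and the Taylor expansion *)

Lemma RInt_cos_0 (n : nat) : (0 < n)%nat -> is_RInt (fun th => cos (INR n * th)) 0 (2 * PI) 0.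
Proof.
intros Hn; assert (Hn' : INR n <> 0) by (apply not_0_INR; lia).
evar_last.
- apply (is_RInt_derive (V := R_CompleteNormedModule) (fun th => / INR n * sin (INR n * th))).
  + intros th _; generalize (INR n) Hn'; intros k Hk; auto_derive; [trivial | field; assumption].
  + intros th _; cont.
- replace (INR n * (2 * PI)) with (0 + 2 * INR n * PI) by ring.
  rewrite sin_period, Rmult_0_r, sin_0; unfold minus, plus, opp; simpl; ring.
Qed.

Lemma RInt_sin_0 (n : nat) : is_RInt (fun th => sin (INR n * th)) 0 (2 * PI) 0.
Proof.
destruct n as [|n].
- apply (is_RInt_ext (V := R_NormedModule)) with (fun _ => 0).
  + intros th _; simpl; rewrite Rmult_0_l, sin_0; reflexivity.
  + evar_last; [apply (is_RInt_const (V := R_NormedModule)) | unfold scal; simpl; unfold mult; simpl; ring].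
- assert (Hn' : INR (S n) <> 0) by (apply not_0_INR; lia).
  evar_last.
  + apply (is_RInt_derive (V := R_CompleteNormedModule) (fun th => - (/ INR (S n) * cos (INR (S n) * th)))).
    * intros th _; generalize (INR (S n)) Hn'; intros k Hk; auto_derive; [trivial|].
      field; assumption.
    * intros th _; cont.
  + replace (INR (S n) * (2 * PI)) with (0 + 2 * INR (S n) * PI) by ring.
    rewrite cos_period, Rmult_0_r, cos_0; unfold minus, plus, opp; simpl; ring.
Qed.

Lemma RInt_opp_0 (f g : R -> R) :
  is_RInt f 0 (2 * PI) 0 -> (forall th, g th = - f th) -> RInt g 0 (2 * PI) = 0.
Proof.
intros H Hg; apply (is_RInt_unique (V := R_CompleteNormedModule)).
apply (is_RInt_ext (V := R_NormedModule)) with (fun th => opp (f th)).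
- intros th _; rewrite Hg; reflexivity.
- evar_last; [apply (is_RInt_opp (V := R_NormedModule)), H | unfold opp; simpl; ring].
Qed.

Lemma is_series_single (u : nat -> R) : (forall n, (0 < n)%nat -> u n = 0) -> is_series u (u 0%nat).
Proof.
intros H.
change (is_lim_seq (sum_n u) (u 0%nat)).
apply is_lim_seq_ext with (fun _ => u 0%nat); [|apply is_lim_seq_const].
induction n as [|n IH]; [rewrite sum_O; reflexivity|].
rewrite sum_Sn, <- IH, (H (S n)) by lia; unfold plus; simpl; ring.
Qed.

(** Cauchy's formula on the fixed circle of radius [r], with its kernel expanded as a geometric
    series. Both are available for real parts only, so they are applied to [F = U + i V] and to
    [- i F = V - i U], whose real part is [V]. *)
Lemma holomorphic_series (U V p q : R * R -> R) (r0 r : R) :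
  0 < r < r0 ->
  (forall x y, Cmod (x, y) < r0 -> CR_at U V p q x y) ->
  exists c d : nat -> R, forall z : C, Cmod z < r ->
    is_series (fun n => fst (Cpow z n) * c n - snd (Cpow z n) * d n) (U z) /\
    is_series (fun n => fst (Cpow z n) * d n + snd (Cpow z n) * c n) (V z).
Proof.
intros Hr HCR.
set (GU := fun th => U (zeta r th)); set (GV := fun th => V (zeta r th)).
assert (Hcont : forall th, continuous GU th /\ continuous GV th).
{ intros th.
  assert (Hg : Cmod (r * cos th, r * sin th) < r0).
  { change (r * cos th, r * sin th) with (zeta r th); rewrite Cmod_zeta; lra. }
  destruct (CR_chain U V p q r0 (fun s => r * cos s) (fun s => r * sin s)
    th (- (r * sin th)) (r * cos th) HCR Hg) as [H1 H2]; try (auto_derive; [trivial | ring]).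
  split; apply (ex_derive_continuous (V := R_NormedModule)); eexists; [exact H1 | exact H2]. }
exists (fun n => / (2 * PI) * fourier_re r GU GV n), (fun n => / (2 * PI) * fourier_im r GU GV n).
intros [a b] Hz.
set (D := fun th => (r * cos th - a) * (r * cos th - a) + (r * sin th - b) * (r * sin th - b)).
assert (HD : forall th, D th <> 0).
{ intros th H; unfold D in H.
  assert (S1 := Rle_0_sqr (r * cos th - a)); assert (S2 := Rle_0_sqr (r * sin th - b)).
  unfold Rsqr in S1, S2.
  assert (H1 : r * cos th = a) by (apply Rminus_diag_uniq, Rsqr_0_uniq; unfold Rsqr; lra).
  assert (H2 : r * sin th = b) by (apply Rminus_diag_uniq, Rsqr_0_uniq; unfold Rsqr; lra).
  assert (H3 := Cmod_zeta r th (proj1 Hr)); unfold zeta in H3; rewrite H1, H2 in H3; lra. }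
(* [w1 + i w2] is [zeta / (zeta - z)], computed as [zeta] times the conjugate of [zeta - z] over
   [D = |zeta - z|^2]. *)
set (w1 := fun th => r * (cos th * (r * cos th - a) + sin th * (r * sin th - b)) * / D th).
set (w2 := fun th => r * (sin th * (r * cos th - a) - cos th * (r * sin th - b)) * / D th).
assert (HDc : forall th, continuous (fun u => / D u) th).
{ intros th; apply continuous_Rinv_comp; [unfold D; cont | apply HD]. }
assert (Hw1 : forall th, continuous w1 th) by (intros th; unfold w1; cont; apply HDc).
assert (Hw2 : forall th, continuous w2 th) by (intros th; unfold w2; cont; apply HDc).
assert (Hw3 : forall th, w1 th * (r * cos th - a) - w2 th * (r * sin th - b) = r * cos th).
{ intros th; unfold w1, w2; specialize (HD th); unfold D in *; field; assumption. }
assert (Hw4 : forall th, w1 th * (r * sin th - b) + w2 th * (r * cos th - a) = r * sin th).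
{ intros th; unfold w1, w2; specialize (HD th); unfold D in *; field; assumption. }
assert (HPI := PI_RGT_0).
(* The kernel is integrated by taking constant [G]: [G = 1] gives the real part of [w] and, below,
   [G = - i] gives its imaginary part. All Fourier terms with [n > 0] vanish. *)
assert (HI1 : RInt w1 0 (2 * PI) = 2 * PI).
{ assert (HS := kernel_series r a b w1 w2 (fun _ => 1) (fun _ => 0) (proj1 Hr) Hz Hw1 Hw2
    (fun th => continuous_const _ _) (fun th => continuous_const _ _) Hw3 Hw4).
  assert (HF : forall n, fourier_re r (fun _ => 1) (fun _ => 0) n = if Nat.eqb n 0 then 2 * PI else 0).
  { intros n; unfold fourier_re.
    rewrite (RInt_ext _ (fun th => cos (INR n * th))) by (intros; simpl; ring).
    destruct n as [|n]; simpl Nat.eqb.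
    - rewrite (RInt_ext _ (fun th => 1)) by (intros; simpl; rewrite Rmult_0_l, cos_0; reflexivity).
      rewrite RInt_const; unfold scal; simpl; unfold mult; simpl; ring.
    - rewrite (is_RInt_unique _ _ _ _ (RInt_cos_0 (S n) ltac:(lia))); simpl; ring. }
  assert (HF2 : forall n, fourier_im r (fun _ => 1) (fun _ => 0) n = 0).
  { intros n; unfold fourier_im.
    rewrite (RInt_opp_0 _ _ (RInt_sin_0 n)) by (intros; simpl; ring); ring. }
  rewrite (RInt_ext w1 (fun th => w1 th * 1 - w2 th * 0)) by (intros; simpl; ring).
  apply is_series_unique in HS; rewrite <- HS.
  apply is_series_unique.
  evar_last; [apply is_series_single|].
  - intros n Hn; rewrite HF, HF2; destruct n; [lia|]; simpl; ring.
  - rewrite HF, HF2; simpl; ring. }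
assert (HI2 : RInt w2 0 (2 * PI) = 0).
{ assert (HS := kernel_series r a b w1 w2 (fun _ => 0) (fun _ => -1) (proj1 Hr) Hz Hw1 Hw2
    (fun th => continuous_const _ _) (fun th => continuous_const _ _) Hw3 Hw4).
  assert (HF : forall n, (0 < n)%nat -> fourier_im r (fun _ => 0) (fun _ => -1) n = 0).
  { intros n Hn; unfold fourier_im.
    rewrite (RInt_opp_0 _ _ (RInt_cos_0 n Hn)) by (intros; simpl; ring); ring. }
  assert (HF2 : forall n, fourier_re r (fun _ => 0) (fun _ => -1) n = 0).
  { intros n; unfold fourier_re.
    rewrite (RInt_opp_0 _ _ (RInt_sin_0 n)) by (intros; simpl; ring); ring. }
  rewrite (RInt_ext w2 (fun th => w1 th * 0 - w2 th * (-1))) by (intros; simpl; ring).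
  apply is_series_unique in HS; rewrite <- HS.
  apply is_series_unique.
  evar_last; [apply is_series_single|].
  - intros n Hn; rewrite HF, HF2 by assumption; ring.
  - rewrite HF2; simpl; ring. }
assert (HU := kernel_series r a b w1 w2 GU GV (proj1 Hr) Hz Hw1 Hw2
  (fun th => proj1 (Hcont th)) (fun th => proj2 (Hcont th)) Hw3 Hw4).
assert (HV := kernel_series r a b w1 w2 GV (fun th => - GU th) (proj1 Hr) Hz Hw1 Hw2
  (fun th => proj2 (Hcont th)) (fun th => continuous_Ropp _ _ (proj1 (Hcont th))) Hw3 Hw4).
assert (HCR' : forall x y, Cmod (x, y) < r0 -> CR_at V (fun z => - U z) q (fun z => - p z) x y).
{ intros x y H; destruct (HCR x y H) as (A1 & A2 & A3 & A4 & A5 & A6).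
  refine (conj A3 (conj _ (conj _ (conj _ (conj A6 _))))).
  - evar_last; [exact A4 | ring].
  - apply (is_derive_opp (V := R_NormedModule)) with (1 := A1).
  - apply (is_derive_opp (V := R_NormedModule)) in A2.
    evar_last; [exact A2 | unfold opp; simpl; ring].
  - apply continuous_Ropp, A5. }
assert (KU := Cauchy_kernel U V p q r0 r a b w1 w2 Hr Hz HCR Hw1 Hw2 Hw3 Hw4).
assert (KV := Cauchy_kernel V (fun z => - U z) q (fun z => - p z) r0 r a b w1 w2 Hr Hz HCR' Hw1 Hw2 Hw3 Hw4).
rewrite HI1, HI2 in KU, KV.
unfold GU, GV in HU; rewrite KU in HU; fold GU GV in HU.
unfold GU, GV in HV; rewrite KV in HV; fold GU GV in HV.
assert (F1 : forall n, fourier_re r GV (fun th => - U (zeta r th)) n = fourier_im r GU GV n).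
{ intros n; unfold fourier_re, fourier_im; f_equal; apply RInt_ext; intros; unfold GU; simpl; ring. }
assert (F2 : forall n, fourier_im r GV (fun th => - U (zeta r th)) n = - fourier_re r GU GV n).
{ intros n; unfold fourier_re, fourier_im.
  rewrite (RInt_ext _ (fun th => scal (-1) (cos (INR n * th) * GU th + sin (INR n * th) * GV th)))
    by (intros; unfold GU, scal; simpl; unfold mult; simpl; ring).
  erewrite is_RInt_unique.
  2: { apply (is_RInt_scal (V := R_NormedModule)), (RInt_correct (V := R_CompleteNormedModule)).
       apply continuous_ex_RInt; intros th; destruct (Hcont th); cont. }
  unfold scal; simpl; unfold mult; simpl; ring. }
split.
- apply (is_series_scal (/ (2 * PI))) in HU.
  evar_last.
  + eapply is_series_ext; [|exact HU].
    intros n; unfold scal; simpl; unfold mult; simpl; ring.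
  + unfold scal; simpl; unfold mult; simpl; field; lra.
- apply (is_series_scal (/ (2 * PI))) in HV.
  evar_last.
  + eapply is_series_ext; [|exact HV].
    intros n; cbv beta; rewrite F1, F2; unfold scal; simpl; unfold mult; simpl; ring.
  + unfold scal; simpl; unfold mult; simpl; field; lra.
Qed.

(** * Quaternion calculus *)

Definition emb (I : quat) (c : C) : quat := slice_pt I (fst c) (snd c).

Ltac qcases :=
  intros;
  repeat match goal with
  | q : ?T |- _ => unify T quat; destruct q as [[[? ?] ?] ?]
  | c : C |- _ => destruct c as [? ?]
  end;
  unfold emb, slice_pt, minus, mult, plus, opp, scal, zero, one; simpl;
  unfold quat_of_R; simpl; unfold mult, plus, opp, zero, one; simpl.

Ltac qring := qcases; apply quat_ext; ring.

(** A nonzero real part would force the other coordinates to be [0] and its own square to be [-1].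
    The norm equation is solved for [b * b] so that [ring [E]] and [field [E]] can use it as a
    rewriting rule. *)
Lemma imag_unit_coords (I : quat) : imag_unit I ->
  exists b c d, I = (0, b, c, d) /\ b * b = 1 - c * c - d * d.
Proof.
destruct I as [[[a b] c] d]; unfold imag_unit; intros H.
injection H; intros H1 H2 H3 H4.
assert (Ha : a = 0).
{ destruct (Req_dec a 0) as [|Ha]; [assumption|exfalso].
  assert (b = 0) by (apply (Rmult_eq_reg_l a); lra).
  assert (c = 0) by (apply (Rmult_eq_reg_l a); lra).
  assert (d = 0) by (apply (Rmult_eq_reg_l a); lra).
  subst; assert (Hs := Rle_0_sqr a); unfold Rsqr in Hs; lra. }
subst; exists b, c, d; split; [reflexivity | lra].
Qed.

Ltac iring HI :=
  let b := fresh "b" in let c := fresh "c" in let d := fresh "d" in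
  let E := fresh "E" in
  destruct (imag_unit_coords _ HI) as (b & c & d & -> & E); clear HI;
  qcases; apply quat_ext; ring [E].

Lemma imag_unit_opp I : imag_unit I -> imag_unit (opp I).
Proof. intros H; unfold imag_unit; rewrite <- H; qring. Qed.

Lemma imag_unit_mult I q : imag_unit I -> mult I (mult I q) = opp q.
Proof. intros H; iring H. Qed.

Lemma emb_mult I c1 c2 : imag_unit I -> emb I (Cmult c1 c2) = mult (emb I c1) (emb I c2).
Proof. intros H; iring H. Qed.

Lemma emb_opp_conj I c : emb (opp I) c = emb I (Cconj c).
Proof. qring. Qed.

Lemma emb_1 I : emb I (RtoC 1) = one.
Proof. qring. Qed.

Lemma mult_emb I c q : mult (emb I c) q = plus (scal (fst c) q) (scal (snd c) (mult I q)).
Proof. qring. Qed.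

Lemma qabs_mult (p q : quat) : qabs (mult p q) = qabs p * qabs q.
Proof.
unfold qabs; rewrite <- sqrt_mult by apply qnormsq_ge_0; f_equal.
destruct p as [[[? ?] ?] ?], q as [[[? ?] ?] ?]; simpl; ring.
Qed.

Lemma qabs_0 : qabs zero = 0.
Proof.
unfold qabs; replace (qnormsq zero) with 0 by (unfold zero; simpl; ring); apply sqrt_0.
Qed.

Lemma qabs_emb I c : imag_unit I -> qabs (emb I c) = Cmod c.
Proof.
intros H; destruct (imag_unit_coords _ H) as (b & d & e & -> & E).
destruct c as [x y]; unfold qabs, Cmod; f_equal.
unfold emb, slice_pt, scal, plus; simpl; ring [E].
Qed.

Lemma is_linear_qmult (c : quat) :
  is_linear (U := quat_NormedModule) (V := quat_NormedModule) (fun q => mult c q).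
Proof.
split.
- intros p q; qring.
- intros k q; qring.
- exists (qabs c + 1); assert (Hc := sqrt_pos (qnormsq c)); fold (qabs c) in Hc.
  split; [lra|]; intros q.
  change (qabs (mult c q) <= (qabs c + 1) * qabs q).
  rewrite qabs_mult; apply Rmult_le_compat_r; [apply sqrt_pos | lra].
Qed.

Definition qcoord (k : nat) (q : quat) : R :=
  let '(a, b, c, d) := q in
  match k with 0%nat => a | 1%nat => b | 2%nat => c | _ => d end.

Lemma is_linear_qcoord k : is_linear (U := quat_NormedModule) (V := R_NormedModule) (qcoord k).
Proof.
split.
- intros [[[? ?] ?] ?] [[[? ?] ?] ?]; destruct k as [|[|[|k]]]; reflexivity.
- intros x [[[? ?] ?] ?]; destruct k as [|[|[|k]]]; reflexivity.
- exists 1; split; [lra|]; intros [[[a b] c] d]; rewrite Rmult_1_l.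
  destruct (Rabs_le_qabs a b c d) as (H1 & H2 & H3 & H4).
  destruct k as [|[|[|k]]]; assumption.
Qed.

Section Linear_maps.

Context {V W : NormedModule R_AbsRing} (l : V -> W).
Hypothesis Hl : is_linear l.

Lemma is_derive_linear (f : R -> V) (x : R) (df : V) :
  is_derive f x df -> is_derive (fun t => l (f t)) x (l df).
Proof.
intros H.
assert (HC := filterdiff_comp' f l x _ _ H (filterdiff_linear l Hl)).
apply filterdiff_ext_lin with (1 := HC); intros y; apply (linear_scal l Hl).
Qed.

Lemma continuous_linear {T : UniformSpace} (f : T -> V) (t : T) :
  continuous f t -> continuous (fun u => l (f u)) t.
Proof.
intros H; apply (continuous_comp f l); [exact H|].
apply (linear_cont l (f t) Hl).
Qed.

Lemma is_series_linear (u : nat -> V) (s : V) :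
  is_series u s -> is_series (fun n => l (u n)) (l s).
Proof.
intros H.
assert (HS : forall n, sum_n (fun n => l (u n)) n = l (sum_n u n)).
{ induction n as [|n IH]; [rewrite !sum_O; reflexivity|].
  rewrite !sum_Sn, IH; symmetry; apply (linear_plus l Hl). }
apply filterlim_ext with (fun n => l (sum_n u n)); [intros n; symmetry; apply HS|].
apply (filterlim_comp _ _ _ (sum_n u) l _ (locally s)); [exact H|].
apply (linear_cont l s Hl).
Qed.

End Linear_maps.

Lemma is_series_quat (u : nat -> quat) (s : quat) :
  (forall k, is_series (fun n => qcoord k (u n)) (qcoord k s)) ->
  is_series (V := quat_NormedModule) u s.
Proof.
intros H.
apply (filterlim_locally (sum_n (G := quat_NormedModule) u)); intros eps.
assert (HS : forall k n, sum_n (fun n => qcoord k (u n)) n = qcoord k (sum_n (G := quat_NormedModule) u n)).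
{ intros k; induction n as [|n IH]; [rewrite !sum_O; reflexivity|].
  rewrite !sum_Sn, IH; symmetry; apply (linear_plus _ (is_linear_qcoord k)). }
assert (HE : forall k, eventually (fun n =>
  Rabs (qcoord k (sum_n (G := quat_NormedModule) u n) - qcoord k s) < eps)).
{ intros k; generalize (proj1 (filterlim_locally _ _) (H k) eps); apply filter_imp.
  intros n Hn; rewrite <- HS; exact Hn. }
generalize (filter_and _ _ (filter_and _ _ (HE 0%nat) (HE 1%nat)) (filter_and _ _ (HE 2%nat) (HE 3%nat))).
apply filter_imp; intros n.
destruct (sum_n (G := quat_NormedModule) u n) as [[[a b] c] d], s as [[[a' b'] c'] d'].
intros [[H0 H1] [H2 H3]]; repeat split; assumption.
Qed.

(** The condition of [regular] on one slice, for an arbitrary function of the coordinates: this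
    covers functions such as slice extensions before they are known to come from a function on
    quaternions. *)
Definition holo (I : quat) (D : R * R -> Prop) (h : R * R -> quat) : Prop :=
  exists fx fy : R * R -> quat,
  forall x y : R, D (x, y) ->
    is_derive (fun t : R => h (t, y)) x (fx (x, y)) /\
    is_derive (fun t : R => h (x, t)) y (fy (x, y)) /\
    continuous fx (x, y) /\
    continuous fy (x, y) /\
    plus (fx (x, y)) (mult I (fy (x, y))) = zero.

Lemma regular_holo (Omega : quat -> Prop) (f : quat -> quat) :
  regular Omega f <->
  forall I, imag_unit I -> holo I (slice Omega I) (fun z => f (emb I z)).
Proof.
split; intros H I HI; destruct (H I HI) as (fx & fy & Hf); exists fx, fy; intros x y Hxy;
  destruct (Hf x y Hxy) as (A1 & A2 & A3 & A4 & A5);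
  refine (conj A1 (conj A2 (conj A3 (conj A4 _)))).
- revert A5; generalize (plus (fx (x, y)) (mult I (fy (x, y)))); intros q Hq.
  destruct q as [[[a b] c] d]; injection Hq; intros; apply quat_ext; lra.
- rewrite A5; apply (scal_zero_r (V := quat_ModuleSpace)).
Qed.

Lemma is_derive_shift {V : NormedModule R_AbsRing} (f : R -> V) (x0 x : R) (l : V) :
  is_derive f (x0 + x) l -> is_derive (fun t => f (x0 + t)) x l.
Proof.
intros H.
assert (Hs : is_derive (fun t : R => x0 + t) x 1) by (auto_derive; [trivial | ring]).
assert (HC := is_derive_comp f (fun t => x0 + t) x l 1 H Hs).
evar_last; [exact HC | exact (scal_one l)].
Qed.

Lemma holo_dy I (fx fy : quat) : imag_unit I ->
  plus fx (mult I fy) = zero -> fy = mult I fx.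
Proof.
intros HI H.
replace fx with (opp (mult I fy)).
- replace (mult I (opp (mult I fy))) with (opp (mult I (mult I fy))) by qring.
  rewrite imag_unit_mult by assumption; qring.
- revert H; generalize (mult I fy); intros [[[? ?] ?] ?]; destruct fx as [[[? ?] ?] ?].
  intros H; injection H; intros; apply quat_ext; lra.
Qed.

Lemma is_series_qmult (c : quat) (u : nat -> quat) (s : quat) :
  is_series (V := quat_NormedModule) u s ->
  is_series (V := quat_NormedModule) (fun n => mult c (u n)) (mult c s).
Proof. apply (is_series_linear (fun q => mult c q) (is_linear_qmult c)). Qed.

Lemma is_series_qplus (u v : nat -> quat) (s t : quat) :
  is_series (V := quat_NormedModule) u s -> is_series (V := quat_NormedModule) v t ->
  is_series (V := quat_NormedModule) (fun n => plus (u n) (v n)) (plus s t).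
Proof. apply (is_series_plus (V := quat_NormedModule)). Qed.

Lemma is_series_qeq (u v : nat -> quat) (s t : quat) :
  is_series (V := quat_NormedModule) u s -> (forall n, u n = v n) -> s = t ->
  is_series (V := quat_NormedModule) v t.
Proof.
intros H Huv <-; apply (is_series_ext (V := quat_NormedModule)) with (1 := Huv); exact H.
Qed.

Lemma qcoord_ext (p q : quat) : (forall k, qcoord k p = qcoord k q) -> p = q.
Proof.
destruct p as [[[? ?] ?] ?], q as [[[? ?] ?] ?]; intros H.
apply quat_ext; [apply (H 0%nat) | apply (H 1%nat) | apply (H 2%nat) | apply (H 3%nat)].
Qed.

(** From [fy = I fx], the [k]-th coordinates of [h] and of [- I h] form a solution of the
    Cauchy-Riemann system for each [k], which gives four scalar Taylor series to be reassembled. *)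
Lemma holo_series I D h (z0 : C) (r0 r : R) :
  imag_unit I -> 0 < r < r0 -> holo I D h ->
  (forall z : C, Cmod (Cminus z z0) < r0 -> D z) ->
  exists a : nat -> quat, forall z : C, Cmod (Cminus z z0) < r ->
    is_series (V := quat_NormedModule) (fun n => mult (emb I (Cpow (Cminus z z0) n)) (a n)) (h z).
Proof.
intros HI Hr (fx & fy & Hf) HD.
assert (Hk : forall k, exists c d : nat -> R, forall z : C, Cmod z < r ->
  is_series (fun n => fst (Cpow z n) * c n - snd (Cpow z n) * d n) (qcoord k (h (Cplus z0 z))) /\
  is_series (fun n => fst (Cpow z n) * d n + snd (Cpow z n) * c n)
    (qcoord k (opp (mult I (h (Cplus z0 z)))))).
{ intros k.
  apply (holomorphic_series (fun z => qcoord k (h (Cplus z0 z)))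
    (fun z => qcoord k (opp (mult I (h (Cplus z0 z)))))
    (fun z => qcoord k (fx (Cplus z0 z)))
    (fun z => qcoord k (opp (mult I (fx (Cplus z0 z))))) r0 r Hr).
  intros x y Hxy.
  assert (HDz : D (Cplus z0 (x, y))).
  { apply HD; replace (Cminus (Cplus z0 (x, y)) z0) with ((x, y) : C); [exact Hxy|].
    apply injective_projections; simpl; ring. }
  destruct z0 as [x0 y0]; unfold Cplus in *; simpl fst in *; simpl snd in *.
  destruct (Hf _ _ HDz) as (A1 & A2 & A3 & A4 & A5).
  apply holo_dy in A5; [|assumption].
  assert (Hc : continuous (fun z : R * R => (x0 + fst z, y0 + snd z)) (x, y)).
  { apply continuous_pair; cont. }
  assert (Hc2 : continuous (fun z : R * R => fx (x0 + fst z, y0 + snd z)) (x, y)).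
  { apply (continuous_comp (fun z : R * R => (x0 + fst z, y0 + snd z)) fx); assumption. }
  assert (HX : is_derive (fun t => h (x0 + t, y0 + y)) x (fx (x0 + x, y0 + y))).
  { apply (is_derive_shift (fun t => h (t, y0 + y))), A1. }
  assert (HY : is_derive (fun t => h (x0 + x, y0 + t)) y (fy (x0 + x, y0 + y))).
  { apply (is_derive_shift (fun t => h (x0 + x, t))), A2. }
  assert (Hl : is_linear (U := quat_NormedModule) (V := quat_NormedModule) (fun q => opp (mult I q))).
  { apply (is_linear_comp (U := quat_NormedModule) (V := quat_NormedModule)
      (fun q => mult I q) opp); [apply is_linear_qmult | apply is_linear_opp]. }
  refine (conj _ (conj _ (conj _ (conj _ (conj _ _))))).
  - apply (is_derive_linear (qcoord k) (is_linear_qcoord k)), HX.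
  - evar_last; [apply (is_derive_linear (qcoord k) (is_linear_qcoord k)), HY|].
    rewrite A5; simpl fst; simpl snd.
    rewrite <- (linear_opp (qcoord k) _ (is_linear_qcoord k)).
    rewrite opp_opp; reflexivity.
  - apply (is_derive_linear (qcoord k) (is_linear_qcoord k)).
    apply (is_derive_linear _ Hl), HX.
  - evar_last.
    + apply (is_derive_linear (qcoord k) (is_linear_qcoord k)).
      apply (is_derive_linear _ Hl), HY.
    + rewrite A5, imag_unit_mult, opp_opp by assumption; reflexivity.
  - apply (continuous_linear (qcoord k) (is_linear_qcoord k)), Hc2.
  - apply (continuous_linear (qcoord k) (is_linear_qcoord k)).
    apply (continuous_linear _ Hl), Hc2. }
destruct (Hk 0%nat) as (c0 & d0 & H0), (Hk 1%nat) as (c1 & d1 & H1),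
  (Hk 2%nat) as (c2 & d2 & H2), (Hk 3%nat) as (c3 & d3 & H3); clear Hk.
set (c := fun n => (c0 n, c1 n, c2 n, c3 n) : quat).
set (d := fun n => (d0 n, d1 n, d2 n, d3 n) : quat).
(* With [z^n = s + i t], the series are [h = sum (s c - t d)] and [- I h = sum (s d + t c)].
   Averaging the first with [I] times the second turns each term into [(s + I t) (c + I d) / 2]. *)
exists (fun n => scal (1 / 2) (plus (c n) (mult I (d n)))).
intros z Hz.
set (w := Cminus z z0) in *.
assert (Ezw : Cplus z0 w = z) by (apply injective_projections; unfold w; simpl; ring).
specialize (H0 w Hz); specialize (H1 w Hz); specialize (H2 w Hz); specialize (H3 w Hz).
rewrite Ezw in *.
assert (HA : is_series (V := quat_NormedModule)
  (fun n => plus (scal (fst (Cpow w n)) (c n)) (scal (- snd (Cpow w n)) (d n))) (h z)).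
{ apply is_series_quat; intros k.
  destruct k as [|[|[|k]]]; (eapply is_series_ext;
    [|first [apply H0 | apply H1 | apply H2 | apply H3]]); intros n; simpl; ring. }
assert (HB : is_series (V := quat_NormedModule)
  (fun n => plus (scal (fst (Cpow w n)) (d n)) (scal (snd (Cpow w n)) (c n))) (opp (mult I (h z)))).
{ apply is_series_quat; intros k.
  destruct k as [|[|[|k]]]; (eapply is_series_ext;
    [|first [apply H0 | apply H1 | apply H2 | apply H3]]); intros n; simpl; ring. }
apply (is_series_qmult I) in HB.
assert (HS := is_series_qplus _ _ _ _ HA HB).
apply (is_series_scal (V := quat_NormedModule) (1 / 2)) in HS.
apply is_series_qeq with (1 := HS).
- intros n; rewrite mult_emb.
  generalize (c n) (d n) (fst (Cpow w n)) (snd (Cpow w n)); clear - HI; intros c d s t.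
  destruct (imag_unit_coords _ HI) as (b & e & f & -> & E); clear HI.
  qcases; apply quat_ext; field [E].
- replace (mult I (opp (mult I (h z)))) with (h z).
  + generalize (h z); clear; intros q; qcases; apply quat_ext; field.
  + replace (opp (mult I (h z))) with (mult I (opp (h z)))
      by (generalize (h z); clear; qring).
    rewrite imag_unit_mult by assumption; generalize (h z); clear; qring.
Qed.

(** * Uniqueness of power series and the identity principle *)

Lemma CV_radius_pos_of_series (a : nat -> R) (t s : R) :
  t <> 0 -> is_series (fun n => t ^ n * a n) s -> Rbar_lt 0 (CV_radius a).
Proof.
intros Ht H.
destruct (Rbar_lt_le_dec 0 (CV_radius a)) as [|Hle]; [assumption|exfalso].
apply (CV_disk_outside a t).
- apply Rbar_le_lt_trans with (1 := Hle); simpl; apply Rabs_pos_lt, Ht.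
- apply ex_series_lim_0; exists s; apply is_series_ext with (2 := H); intros n; simpl; ring.
Qed.

Lemma real_power_series_unique (a b : nat -> R) (e : R) : 0 < e ->
  (forall t, Rabs t < e -> exists s,
    is_series (fun n => t ^ n * a n) s /\ is_series (fun n => t ^ n * b n) s) ->
  forall n, a n = b n.
Proof.
intros He H n.
assert (He2 : Rabs (e / 2) < e) by (rewrite Rabs_pos_eq; lra).
destruct (H (e / 2) He2) as (s & Ha & Hb).
apply PSeries_ext_recip.
- apply (CV_radius_pos_of_series a (e / 2) s); [lra | exact Ha].
- apply (CV_radius_pos_of_series b (e / 2) s); [lra | exact Hb].
- exists (mkposreal e He); intros t Ht.
  change (Rabs (t - 0) < e) in Ht; rewrite Rminus_0_r in Ht.
  destruct (H t Ht) as (st & Hat & Hbt).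
  assert (E : forall c, PSeries c t = Series (fun n => t ^ n * c n)).
  { intros c; apply Series_ext; intros k; ring. }
  rewrite !E, (is_series_unique _ _ Hat), (is_series_unique _ _ Hbt); reflexivity.
Qed.

Lemma quat_power_series_unique (a b : nat -> quat) (e : R) : 0 < e ->
  (forall t, Rabs t < e -> exists s,
    is_series (V := quat_NormedModule) (fun n => scal (t ^ n) (a n)) s /\
    is_series (V := quat_NormedModule) (fun n => scal (t ^ n) (b n)) s) ->
  forall n, a n = b n.
Proof.
intros He H n; apply qcoord_ext; intros k.
apply (real_power_series_unique (fun n => qcoord k (a n)) (fun n => qcoord k (b n)) e He).
intros t Ht; destruct (H t Ht) as (s & Ha & Hb).
exists (qcoord k s); split.
- apply (is_series_linear (qcoord k) (is_linear_qcoord k)) in Ha.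
  apply is_series_ext with (2 := Ha); intros m; apply (linear_scal _ (is_linear_qcoord k)).
- apply (is_series_linear (qcoord k) (is_linear_qcoord k)) in Hb.
  apply is_series_ext with (2 := Hb); intros m; apply (linear_scal _ (is_linear_qcoord k)).
Qed.

Lemma quat_series_unique (u : nat -> quat) (s t : quat) :
  is_series (V := quat_NormedModule) u s -> is_series (V := quat_NormedModule) u t -> s = t.
Proof.
intros H1 H2; apply qcoord_ext; intros k.
apply (is_series_linear (qcoord k) (is_linear_qcoord k)) in H1.
apply (is_series_linear (qcoord k) (is_linear_qcoord k)) in H2.
apply is_series_unique in H1; apply is_series_unique in H2; congruence.
Qed.

Lemma is_series_q0 (u : nat -> quat) : (forall n, u n = zero) ->
  is_series (V := quat_NormedModule) u zero.
Proof.
intros H; apply is_series_quat; intros k.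
apply is_series_ext with (fun _ => 0).
- intros n; rewrite H; destruct k as [|[|[|k]]]; reflexivity.
- evar_last; [apply (is_series_single (fun _ => 0)); reflexivity|].
  destruct k as [|[|[|k]]]; reflexivity.
Qed.

Lemma emb_pow_real I (t : R) (n : nat) (q : quat) :
  mult (emb I (Cpow (RtoC t) n)) q = scal (t ^ n) q.
Proof. rewrite <- RtoC_pow; generalize (t ^ n); qring. Qed.

Lemma Cmod_half_disc (z w v : C) (r : R) :
  Cmod (Cminus w z) < r / 2 -> Cmod (Cminus v w) < r / 2 -> Cmod (Cminus v z) < r.
Proof.
intros H1 H2.
replace (Cminus v z) with (Cplus (Cminus v w) (Cminus w z)) by ring.
apply Rle_lt_trans with (1 := Cmod_triangle _ _); lra.
Qed.

Lemma Cmod_lt_locally_center (z0 : C) (r : R) (z : R * R) :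
  Cmod (Cminus z z0) < r -> locally z (fun w : R * R => Cmod (Cminus w z0) < r).
Proof.
intros H.
assert (Hc : continuous (fun w : R * R => Cminus w z0 : R * R) z).
{ apply (continuous_pair (fun w : R * R => fst w + - fst z0) (fun w : R * R => snd w + - snd z0)); cont. }
exact (Hc _ (Cmod_lt_locally r (Cminus z z0) H)).
Qed.

Lemma open_disc (D : R * R -> Prop) (z : R * R) : open D -> D z ->
  exists r, 0 < r /\ forall w : C, Cmod (Cminus w z) < r -> D w.
Proof.
intros HD Hz; destruct (HD z Hz) as [r Hr]; exists r; split; [apply cond_pos|].
intros w Hw; apply Hr.
assert (HM := Rmax_Cmod (Cminus w z)).
split.
- apply Rle_lt_trans with (2 := Hw), Rle_trans with (2 := HM), Rmax_l.
- apply Rle_lt_trans with (2 := Hw), Rle_trans with (2 := HM), Rmax_r.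
Qed.

(** On the horizontal segment through [z0] the powers of [z - z0] are real, so the expansion
    restricts to a real power series with the same coefficients; these vanish, and with them [h] on
    the whole disc. *)
Lemma holo_zero_disc I D h (z0 : C) (r0 e : R) :
  imag_unit I -> holo I D h -> 0 < e ->
  (forall z : C, Cmod (Cminus z z0) < r0 -> D z) ->
  (forall t, Rabs t < e -> h (fst z0 + t, snd z0) = zero) ->
  forall z : C, Cmod (Cminus z z0) < r0 -> h z = zero.
Proof.
intros HI Hh He HD H0 z Hz.
(* The midpoint keeps [z] inside the disc of radius [r] and [r] strictly below [r0]. *)
set (r := (r0 + Cmod (Cminus z z0)) / 2).
assert (Hp := Cmod_ge_0 (Cminus z z0)).
destruct (holo_series I D h z0 r0 r HI ltac:(unfold r; lra) Hh HD) as [a Ha].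
assert (Ha0 : forall n, a n = zero).
{ apply (quat_power_series_unique a (fun _ => zero) (Rmin e r)).
  - apply Rmin_pos; unfold r; lra.
  - intros t Ht.
    assert (Ht1 : Rabs t < e) by (apply Rlt_le_trans with (1 := Ht), Rmin_l).
    assert (Ht2 : Rabs t < r) by (apply Rlt_le_trans with (1 := Ht), Rmin_r).
    exists zero; split.
    + assert (E : Cminus (fst z0 + t, snd z0) z0 = RtoC t)
        by (apply injective_projections; simpl; ring).
      specialize (Ha (fst z0 + t, snd z0)).
      rewrite E, Cmod_R in Ha; specialize (Ha Ht2); rewrite (H0 t Ht1) in Ha.
      apply is_series_qeq with (1 := Ha); [intros n; apply emb_pow_real | reflexivity].
    + apply is_series_q0; intros n; generalize (t ^ n); qring. }
apply quat_series_unique with (1 := Ha z ltac:(unfold r; lra)).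
apply is_series_q0; intros n; rewrite Ha0; generalize (emb I (Cpow (Cminus z z0) n)); qring.
Qed.

(** The points of [D] around which [h] vanishes on a horizontal segment form a set that is open and
    closed in [D]: such a segment spreads to a disc of zeros. *)
Lemma identity_principle I D h (z0 : R * R) (e : R) :
  imag_unit I -> Defs.domain D -> holo I D h -> D z0 -> 0 < e ->
  (forall t, Rabs t < e -> h (fst z0 + t, snd z0) = zero) ->
  forall z, D z -> h z = zero.
Proof.
intros HI [Ho Hc] Hh Hz0 He H0.
set (U := fun z : R * R => D z /\ exists e, 0 < e /\ forall t, Rabs t < e -> h (fst z + t, snd z) = zero).
set (V := fun z : R * R => D z /\ ~ U z).
assert (Hline : forall (z w : C) r, Cmod (Cminus z w) < r ->
  (forall v : C, Cmod (Cminus v w) < r -> h v = zero) ->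
  exists e, 0 < e /\ forall t, Rabs t < e -> h (fst z + t, snd z) = zero).
{ intros z w r Hzw Hv; exists (r - Cmod (Cminus z w)); split; [lra|].
  intros t Ht; apply Hv.
  replace (Cminus (fst z + t, snd z) w) with (Cplus (Cminus z w) (RtoC t))
    by (apply injective_projections; simpl; ring).
  apply Rle_lt_trans with (1 := Cmod_triangle _ _); rewrite Cmod_R; lra. }
assert (HU : open U).
{ intros z [HDz (e' & He' & Hz)].
  destruct (open_disc D z Ho HDz) as (r & Hr & HDr).
  assert (Hzero := holo_zero_disc I D h z r e' HI Hh He' HDr Hz).
  assert (Hzz : Cmod (Cminus z z) < r)
    by (replace (Cminus z z) with (RtoC 0) by ring; rewrite Cmod_0; exact Hr).
  generalize (Cmod_lt_locally_center z r z Hzz); apply filter_imp.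
  intros w Hw; split; [apply HDr, Hw | apply (Hline w z r Hw Hzero)]. }
(* If [w] within [r / 2] of [z] were in [U], then [h] would vanish on the disc of radius [r / 2]
   about [w], which stays in [D] and contains [z]; so [z] would be in [U]. *)
assert (HV : open V).
{ intros z [HDz Hz].
  destruct (open_disc D z Ho HDz) as (r & Hr & HDr).
  assert (Hzz : Cmod (Cminus z z) < r / 2)
    by (replace (Cminus z z) with (RtoC 0) by ring; rewrite Cmod_0; lra).
  generalize (Cmod_lt_locally_center z (r / 2) z Hzz); apply filter_imp.
  intros w Hw; split; [apply HDr; lra|].
  intros [HDw (e' & He' & Hw')]; apply Hz; split; [exact HDz|].
  assert (Hzw : Cmod (Cminus z w) < r / 2).
  { rewrite <- Cmod_opp; replace (Copp (Cminus z w)) with (Cminus w z) by ring; exact Hw. }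
  apply (Hline z w (r / 2) Hzw).
  apply (holo_zero_disc I D h w (r / 2) e' HI Hh He'); [|exact Hw'].
  intros v Hv; apply HDr, (Cmod_half_disc z w v r Hw Hv). }
intros z Hz.
destruct (excluded_middle_informative (U z)) as [[_ (e' & He' & Hz')]|Hn].
- specialize (Hz' 0); rewrite Rabs_R0, Rplus_0_r in Hz'; destruct z; apply Hz', He'.
- exfalso; destruct (Hc U V HU HV) as (w & _ & Hw1 & _ & Hw2); [| | |exact (Hw2 Hw1)].
  + intros w Hw; destruct (excluded_middle_informative (U w)); [left | right; split]; assumption.
  + exists z0; repeat split; try assumption; exists e; split; assumption.
  + exists z; repeat split; assumption.
Qed.

(** * The extension formula *)

Definition ext_l (I J : quat) : quat := scal (1 / 2) (minus one (mult J I)).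
Definition ext_r (I J : quat) : quat := scal (1 / 2) (plus one (mult J I)).

(* The value at [x + J y] of the slice extension of [g], where [g] is given on
   [R + I R]. *)
Definition ext (I J : quat) (g : R * R -> quat) (z : R * R) : quat :=
  plus (mult (ext_l I J) (g z)) (mult (ext_r I J) (g (Cconj z))).

Ltac iring2 HI HJ :=
  let b := fresh "b" in let c := fresh "c" in let d := fresh "d" in
  let b' := fresh "b" in let c' := fresh "c" in let d' := fresh "d" in
  let E := fresh "E" in let E' := fresh "E" in
  destruct (imag_unit_coords _ HI) as (b & c & d & -> & E); clear HI;
  destruct (imag_unit_coords _ HJ) as (b' & c' & d' & -> & E'); clear HJ;
  qcases; apply quat_ext; field [E E'].

Lemma ext_l_comm I J q : imag_unit I -> imag_unit J ->
  mult J (mult (ext_l I J) q) = mult (ext_l I J) (mult I q).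
Proof. intros HI HJ; unfold ext_l; iring2 HI HJ. Qed.

Lemma ext_r_comm I J q : imag_unit I -> imag_unit J ->
  mult J (mult (ext_r I J) q) = opp (mult (ext_r I J) (mult I q)).
Proof. intros HI HJ; unfold ext_r; iring2 HI HJ. Qed.

Lemma ext_lr_real I J q : plus (mult (ext_l I J) q) (mult (ext_r I J) q) = q.
Proof. unfold ext_l, ext_r; qcases; apply quat_ext; field. Qed.

(** [x + J y] is also [x + (- J) (- y)]; the two readings must agree for the extension to be a
    function on quaternions. *)
Lemma ext_opp I J g x y : ext I (opp J) g (x, - y) = ext I J g (x, y).
Proof.
unfold ext; replace (Cconj (x, - y)) with ((x, y) : C)
  by (apply injective_projections; simpl; ring).
change (Cconj (x, y)) with (x, - y).
generalize (g (x, y)) (g (x, - y)); unfold ext_l, ext_r; qcases; apply quat_ext; field.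
Qed.

Lemma ext_real I J g x : ext I J g (x, 0) = g (x, 0).
Proof.
unfold ext; replace (Cconj (x, 0)) with ((x, 0) : C)
  by (apply injective_projections; simpl; ring).
apply ext_lr_real.
Qed.

Lemma ext_same I g z : imag_unit I -> ext I I g z = g z.
Proof.
intros HI; unfold ext; generalize (g z) (g (Cconj z)); intros p q; unfold ext_l, ext_r.
destruct (imag_unit_coords _ HI) as (b & c & d & -> & E); clear HI.
qcases; apply quat_ext; field [E].
Qed.

(** [J A = A I] turns holomorphy for [I] into holomorphy for [J]. In the other term the sign from
    conjugating the variable is cancelled by that in [J B = - B I]. *)
Lemma holo_ext I J D g : imag_unit I -> imag_unit J ->
  (forall z, D z -> D (Cconj z)) -> holo I D g -> holo J D (ext I J g).
Proof.
intros HI HJ HD (fx & fy & Hf).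
exists (ext I J fx), (fun z => minus (mult (ext_l I J) (fy z)) (mult (ext_r I J) (fy (Cconj z)))).
intros x y Hxy; assert (Hxy' := HD _ Hxy); unfold Cconj in Hxy'; simpl fst in Hxy'; simpl snd in Hxy'.
destruct (Hf _ _ Hxy) as (A1 & A2 & A3 & A4 & A5), (Hf _ _ Hxy') as (B1 & B2 & B3 & B4 & B5).
assert (Hc : forall c, is_linear (U := quat_NormedModule) (V := quat_NormedModule) (fun q => mult c q))
  by apply is_linear_qmult.
assert (HC : continuous (fun z : R * R => Cconj z : R * R) (x, y)).
{ apply (continuous_pair fst (fun z : R * R => - snd z)); cont. }
refine (conj _ (conj _ (conj _ (conj _ _)))).
- apply (is_derive_plus (V := quat_NormedModule)); apply (is_derive_linear _ (Hc _)); assumption.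
- assert (B2' : is_derive (fun t => g (x, - t)) y (opp (fy (x, - y)))).
  { assert (Hs : is_derive (fun t : R => - t) y (-1)) by (auto_derive; [trivial | ring]).
    evar_last; [exact (is_derive_comp (fun t => g (x, t)) (fun t => - t) y _ _ B2 Hs)|].
    generalize (fy (x, - y)); qring. }
  evar_last.
  + apply (is_derive_plus (V := quat_NormedModule)); apply (is_derive_linear _ (Hc _)); [exact A2 | exact B2'].
  + change (Cconj (x, y)) with (x, - y).
    generalize (fy (x, y)) (fy (x, - y)) (ext_l I J) (ext_r I J); clear; qring.
- apply (continuous_plus (V := quat_NormedModule)); apply (continuous_linear _ (Hc _)).
  + exact A3.
  + apply (continuous_comp (fun z : R * R => Cconj z : R * R) fx); assumption.
- apply (continuous_minus (V := quat_NormedModule)); apply (continuous_linear _ (Hc _)).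
  + exact A4.
  + apply (continuous_comp (fun z : R * R => Cconj z : R * R) fy); assumption.
- unfold ext; change (Cconj (x, y)) with (x, - y).
  revert A5 B5; generalize (fx (x, y)) (fy (x, y)) (fx (x, - y)) (fy (x, - y)).
  intros p1 q1 p2 q2 A5 B5.
  transitivity (plus (mult (ext_l I J) (plus p1 (mult I q1))) (mult (ext_r I J) (plus p2 (mult I q2)))).
  + replace (mult J (minus (mult (ext_l I J) q1) (mult (ext_r I J) q2))) with
      (minus (mult J (mult (ext_l I J) q1)) (mult J (mult (ext_r I J) q2)))
      by (generalize (ext_l I J) (ext_r I J); clear; qring).
    rewrite ext_l_comm, ext_r_comm by assumption.
    generalize (ext_l I J) (ext_r I J) (mult I q1) (mult I q2); clear; qring.
  + rewrite A5, B5; generalize (ext_l I J) (ext_r I J); clear; qring.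
Qed.

Lemma holo_minus I D g h : holo I D g -> holo I D h -> holo I D (fun z => minus (g z) (h z)).
Proof.
intros (gx & gy & Hg) (hx & hy & Hh).
exists (fun z => minus (gx z) (hx z)), (fun z => minus (gy z) (hy z)).
intros x y Hxy; destruct (Hg x y Hxy) as (A1 & A2 & A3 & A4 & A5), (Hh x y Hxy) as (B1 & B2 & B3 & B4 & B5).
refine (conj _ (conj _ (conj _ (conj _ _)))).
- apply (is_derive_minus (V := quat_NormedModule)); assumption.
- apply (is_derive_minus (V := quat_NormedModule)); assumption.
- apply (continuous_minus (V := quat_NormedModule)); assumption.
- apply (continuous_minus (V := quat_NormedModule)); assumption.
- transitivity (minus (plus (gx (x, y)) (mult I (gy (x, y)))) (plus (hx (x, y)) (mult I (hy (x, y))))).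
  + generalize (gx (x, y)) (gy (x, y)) (hx (x, y)) (hy (x, y)); clear; qring.
  + rewrite A5, B5; clear; qring.
Qed.

Lemma holo_ext_eq I D D' g h : (forall z, D' z -> D z) -> (forall z, g z = h z) ->
  holo I D g -> holo I D' h.
Proof.
intros HD Hgh (fx & fy & Hf); exists fx, fy; intros x y Hxy.
destruct (Hf x y (HD _ Hxy)) as (A1 & A2 & A3 & A4 & A5).
refine (conj _ (conj _ (conj A3 (conj A4 A5)))).
- apply is_derive_ext with (2 := A1); intros t; apply Hgh.
- apply is_derive_ext with (2 := A2); intros t; apply Hgh.
Qed.

Lemma symmetric_emb Omega I J z : symmetric Omega -> imag_unit I -> imag_unit J ->
  Omega (emb I z) -> Omega (emb J z).
Proof.
intros HS HI HJ H; apply (HS I (fst z) (snd z) HI H); exists J; split; [assumption | reflexivity].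
Qed.

Lemma symmetric_emb_conj Omega I z : symmetric Omega -> imag_unit I ->
  Omega (emb I z) -> Omega (emb I (Cconj z)).
Proof.
intros HS HI H; rewrite <- emb_opp_conj.
apply (symmetric_emb Omega I); auto using imag_unit_opp.
Qed.

Lemma emb_real I x : emb I (x, 0) = quat_of_R x.
Proof. qring. Qed.

Lemma representation Omega f I J z :
  symmetric Omega -> slice_domain Omega -> regular Omega f ->
  imag_unit I -> imag_unit J -> Omega (emb J z) ->
  f (emb J z) = ext I J (fun z => f (emb I z)) z.
Proof.
intros HS (_ & [x0 Hx0] & Hsl) Hf HI HJ Hz.
set (h := fun z => minus (f (emb J z)) (ext I J (fun z => f (emb I z)) z)).
assert (Hh : holo J (slice Omega J) h).
{ apply holo_minus.
  - apply regular_holo; assumption.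
  - apply holo_ext; [assumption | assumption | |].
    + intros w Hw; exact (symmetric_emb_conj Omega J w HS HJ Hw).
    + apply holo_ext_eq with (D := slice Omega I) (g := fun z => f (emb I z)).
      * intros w Hw; exact (symmetric_emb Omega J I w HS HJ HI Hw).
      * reflexivity.
      * apply regular_holo; assumption. }
assert (H0 : h z = zero).
(* The difference vanishes at every real coordinate because [A + B = 1], so the length [1] is
   arbitrary. *)
{ apply (identity_principle J (slice Omega J) h (x0, 0) 1 HJ (Hsl J HJ) Hh).
  - change (Omega (emb J (x0, 0))); rewrite emb_real; exact Hx0.
  - lra.
  - intros t _; unfold h; simpl fst; simpl snd; rewrite ext_real, !emb_real.
    generalize (f (quat_of_R (x0 + t))); clear; qring.
  - exact Hz. }
revert H0; unfold h; generalize (f (emb J z)) (ext I J (fun z => f (emb I z)) z).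
clear; intros [[[a b] c] d] [[[a' b'] c'] d'] H; injection H; intros; apply quat_ext; lra.
Qed.

(** * Star powers *)

Lemma imag_unit_exists : exists I, imag_unit I.
Proof. exists (0, 1, 0, 0); apply quat_ext; simpl; ring. Qed.

Lemma qre_emb I z : imag_unit I -> qre (emb I z) = fst z.
Proof.
intros HI; destruct (imag_unit_coords _ HI) as (b & c & d & -> & E); destruct z.
unfold emb, slice_pt, scal, plus; simpl; ring.
Qed.

Lemma qim_emb I z : imag_unit I -> qim (emb I z) = scal (snd z) I.
Proof.
intros HI; destruct (imag_unit_coords _ HI) as (b & c & d & -> & E); destruct z.
unfold emb, slice_pt, scal, plus; simpl; apply quat_ext; ring.
Qed.

Lemma qabs_imag I : imag_unit I -> qabs I = 1.
Proof.
intros HI; destruct (imag_unit_coords _ HI) as (b & c & d & -> & E).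
unfold qabs; rewrite <- sqrt_1; f_equal; simpl; lra.
Qed.

Lemma qabs_qim_emb I z : imag_unit I -> qabs (qim (emb I z)) = Rabs (snd z).
Proof.
intros HI; rewrite qim_emb by assumption.
destruct (imag_unit_coords _ HI) as (b & c & d & -> & E).
unfold qabs; rewrite <- sqrt_Rsqr_abs; f_equal; unfold Rsqr; simpl.
ring [E].
Qed.

Lemma emb_surj (q : quat) : exists J z, imag_unit J /\ q = emb J z /\ 0 <= snd z.
Proof.
destruct (Req_dec (qabs (qim q)) 0) as [H|H].
- destruct imag_unit_exists as [J HJ]; exists J, (qre q, 0); repeat split; [assumption| |apply Rle_refl].
  apply qabs_eq_0 in H; destruct q as [[[a b] c] d]; injection H; intros; subst; qring.
- exists (scal (/ qabs (qim q)) (qim q)), (qre q, qabs (qim q)).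
  assert (HP : 0 <= qabs (qim q)) by apply sqrt_pos.
  assert (HS : qabs (qim q) * qabs (qim q) = qnormsq (qim q)) by (apply sqrt_sqrt, qnormsq_ge_0).
  revert H HP HS; generalize (qabs (qim q)); intros n H HP HS.
  destruct q as [[[a b] c] d]; simpl in HS.
  repeat split; [| |exact HP].
  + unfold imag_unit, mult, opp, scal, one; simpl; unfold quat_of_R; simpl.
    apply quat_ext; apply (Rmult_eq_reg_l (n * n)); try nra; field_simplify; try assumption; try nra.
  + unfold emb, slice_pt, plus, scal; simpl; apply quat_ext; field; assumption.
Qed.

(* [/ 0 = 0] makes this correct at real [q] as well. *)
Definition ext_fun (I : quat) (g : R * R -> quat) (q : quat) : quat :=
  ext I (scal (/ qabs (qim q)) (qim q)) g (qre q, qabs (qim q)).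

Lemma ext_fun_emb I J g z : imag_unit J -> ext_fun I g (emb J z) = ext I J g z.
Proof.
intros HJ; unfold ext_fun; rewrite qre_emb, qabs_qim_emb, qim_emb by assumption.
destruct z as [x y]; simpl fst; simpl snd.
destruct (Rtotal_order y 0) as [H|[->|H]].
- rewrite Rabs_left by assumption.
  replace (scal (/ - y) (scal y J)) with (opp J).
  + rewrite <- (ext_opp I J g x y); reflexivity.
  + clear - H; qcases; apply quat_ext; field; lra.
- rewrite Rabs_R0, !ext_real; reflexivity.
- rewrite Rabs_pos_eq by lra; f_equal.
  clear - H; qcases; apply quat_ext; field; lra.
Qed.

Definition CpowZ (c : C) (n : Z) : C :=
  match n with
  | Z0 => RtoC 1
  | Zpos k => Cpow c (Pos.to_nat k)
  | Zneg k => Cpow (Cinv c) (Pos.to_nat k)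
  end.

Lemma pow_n_emb I c k : imag_unit I -> pow_n (emb I c) k = emb I (Cpow c k).
Proof.
intros HI; induction k as [|k IH].
- symmetry; apply emb_1.
- rewrite Cpow_S, emb_mult, <- IH by assumption; reflexivity.
Qed.

Lemma qinv_emb I c : imag_unit I -> qinv (emb I c) = emb I (Cinv c).
Proof.
intros HI; destruct (imag_unit_coords _ HI) as (b & d & e & -> & E); destruct c as [x y].
assert (EN : qnormsq (emb (0, b, d, e) (x, y)) = x ^ 2 + y ^ 2).
{ unfold emb, slice_pt, scal, plus; simpl; ring [E]. }
unfold qinv; rewrite EN; unfold Cinv, Rdiv; simpl fst; simpl snd.
generalize (/ (x ^ 2 + y ^ 2)); intros r.
unfold emb, slice_pt, scal, plus; simpl; apply quat_ext; ring.
Qed.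

Lemma qpowZ_emb I c n : imag_unit I -> qpowZ (emb I c) n = emb I (CpowZ c n).
Proof.
intros HI; destruct n as [|k|k]; simpl.
- symmetry; apply emb_1.
- apply pow_n_emb, HI.
- rewrite qinv_emb by assumption; apply pow_n_emb, HI.
Qed.

Lemma CpowZ_conj c n : CpowZ (Cconj c) n = Cconj (CpowZ c n).
Proof.
assert (HI : Cinv (Cconj c) = Cconj (Cinv c)).
{ destruct c as [x y]; unfold Cconj, Cinv, Rdiv; simpl fst; simpl snd.
  replace ((- y) ^ 2) with (y ^ 2) by ring; apply injective_projections; simpl; ring. }
destruct n as [|k|k]; simpl.
- apply injective_projections; simpl; ring.
- symmetry; apply Cpow_conj.
- rewrite HI; symmetry; apply Cpow_conj.
Qed.

Lemma emb_minus I c1 c2 : minus (emb I c1) (emb I c2) = emb I (Cminus c1 c2).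
Proof. qring. Qed.

Lemma is_derive_scal_fun (A : R -> R) (h : R -> quat) (x a : R) (dh : quat) :
  is_derive A x a -> is_derive h x dh ->
  is_derive (fun t => scal (A t) (h t)) x (plus (scal a (h x)) (scal (A x) dh)).
Proof.
intros HA Hh.
assert (HC := filterdiff_scal_fct x A h _ _ Rmult_comm HA Hh).
apply filterdiff_ext_lin with (1 := HC).
intros y; generalize (h x) (A x); clear; intros.
unfold scal at 2 4; simpl; unfold mult; simpl; qring.
Qed.

(** Left factors from the line of [I] commute with [I], so the product rule preserves the left
    equation. Continuity of [h] enters the derivatives of the product, hence its place in the
    conclusion, for iteration. *)
Lemma holo_mult I D A B p q h : imag_unit I ->
  (forall x y, D (x, y) -> CR_at A B p q x y /\ continuous A (x, y) /\ continuous B (x, y)) ->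
  holo I D h -> (forall z, D z -> continuous h z) ->
  holo I D (fun z => mult (emb I (A z, B z)) (h z)) /\
  (forall z, D z -> continuous (fun z => mult (emb I (A z, B z)) (h z)) z).
Proof.
intros HI HAB (fx & fy & Hf) Hh.
assert (HE : forall (u v : R * R -> R) (g : R * R -> quat) (z : R * R),
  continuous u z -> continuous v z -> continuous g z ->
  continuous (fun z => mult (emb I (u z, v z)) (g z)) z).
{ intros u v g z Hu Hv Hg.
  apply continuous_ext with (fun z => plus (scal (u z) (g z)) (scal (v z) (mult I (g z)))).
  - intros w; symmetry; apply mult_emb.
  - apply (continuous_plus (V := quat_NormedModule)); apply (continuous_scal (V := quat_NormedModule)); auto.
    apply (continuous_linear _ (is_linear_qmult I)), Hg. }
assert (HDE : forall (u v : R -> R) (g : R -> quat) (t du dv : R) (dg : quat),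
  is_derive u t du -> is_derive v t dv -> is_derive g t dg ->
  is_derive (fun s => mult (emb I (u s, v s)) (g s)) t
    (plus (mult (emb I (du, dv)) (g t)) (mult (emb I (u t, v t)) dg))).
{ intros u v g t du dv dg Hu Hv Hg.
  apply is_derive_ext with (fun s => plus (scal (u s) (g s)) (scal (v s) (mult I (g s)))).
  - intros s; symmetry; apply mult_emb.
  - evar_last.
    + apply (is_derive_plus (V := quat_NormedModule)); apply is_derive_scal_fun;
        [exact Hu | exact Hg | exact Hv | apply (is_derive_linear _ (is_linear_qmult I)), Hg].
    + cbv beta; generalize (g t) (u t) (v t); clear; qring. }
split.
- exists (fun z => plus (mult (emb I (p z, q z)) (h z)) (mult (emb I (A z, B z)) (fx z))),
    (fun z => plus (mult (emb I (- q z, p z)) (h z)) (mult (emb I (A z, B z)) (fy z))).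
  intros x y Hxy; destruct (HAB x y Hxy) as ((C1 & C2 & C3 & C4 & C5 & C6) & CA & CB).
  destruct (Hf x y Hxy) as (A1 & A2 & A3 & A4 & A5); specialize (Hh _ Hxy).
  refine (conj _ (conj _ (conj _ (conj _ _)))).
  + apply (HDE (fun t => A (t, y)) (fun t => B (t, y)) (fun t => h (t, y))); assumption.
  + apply (HDE (fun t => A (x, t)) (fun t => B (x, t)) (fun t => h (x, t))); assumption.
  + apply (continuous_plus (V := quat_NormedModule)); apply HE; assumption.
  + apply (continuous_plus (V := quat_NormedModule)); apply HE; try assumption.
    apply continuous_Ropp; assumption.
  + apply holo_dy in A5; [|assumption]; rewrite A5.
    generalize (h (x, y)) (fx (x, y)) (A (x, y)) (B (x, y)) (p (x, y)) (q (x, y)).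
    clear - HI; intros h f a b p q; iring HI.
- intros z Hz; destruct (HAB (fst z) (snd z)) as (_ & CA & CB); [destruct z; exact Hz|].
  rewrite <- surjective_pairing in CA, CB; apply HE; auto.
Qed.

(** The base [A + i B] is general in order to serve both for [z - z0] and for its inverse. *)
Lemma holo_pow I D A B p q k : imag_unit I ->
  (forall x y, D (x, y) -> CR_at A B p q x y /\ continuous A (x, y) /\ continuous B (x, y)) ->
  holo I D (fun z => emb I (Cpow (A z, B z) k)) /\
  (forall z, D z -> continuous (fun z => emb I (Cpow (A z, B z) k)) z).
Proof.
intros HI HAB; induction k as [|k [IH1 IH2]].
- split; [|intros; apply continuous_const].
  apply (holo_ext_eq I D D (fun _ => emb I (RtoC 1))); [auto | reflexivity |].
  exists (fun _ => zero), (fun _ => zero); intros x y _.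
  refine (conj _ (conj _ (conj _ (conj _ _)))).
  + apply (is_derive_const (V := quat_NormedModule)).
  + apply (is_derive_const (V := quat_NormedModule)).
  + apply continuous_const.
  + apply continuous_const.
  + clear; qring.
- destruct (holo_mult I D A B p q _ HI HAB IH1 IH2) as [H1 H2]; split.
  + apply holo_ext_eq with (3 := H1); [auto|].
    intros z; rewrite Cpow_S; symmetry; apply emb_mult, HI.
  + intros z Hz; apply continuous_ext with (2 := H2 z Hz).
    intros w; rewrite Cpow_S; symmetry; apply emb_mult, HI.
Qed.

Lemma emb_unit_eq I K z w : imag_unit I -> imag_unit K -> emb K w = emb I z -> snd z <> 0 ->
  K = I \/ K = opp I.
Proof.
intros HI HK H Hz.
assert (H1 := f_equal qim H); rewrite !qim_emb in H1 by assumption.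
assert (H2 := f_equal (fun q => qabs (qim q)) H); simpl in H2; rewrite !qabs_qim_emb in H2 by assumption.
destruct z as [x y], w as [u v]; simpl fst in *; simpl snd in *.
assert (Hv : v = y \/ v = - y).
{ revert H2; unfold Rabs; destruct (Rcase_abs v), (Rcase_abs y); intros; lra. }
destruct I as [[[i0 i1] i2] i3], K as [[[k0 k1] k2] k3].
injection H1; intros E1 E2 E3 E4.
destruct Hv as [-> | ->]; [left | right]; apply quat_ext; apply (Rmult_eq_reg_l y); simpl; lra.
Qed.

Lemma same_line_emb I z w : imag_unit I -> same_line (emb I z) (emb I w).
Proof.
intros HI; exists I; split; [assumption|]; split.
- exists (fst z), (snd z); reflexivity.
- exists (fst w), (snd w); reflexivity.
Qed.

Lemma same_line_nonreal I z q : imag_unit I -> snd z <> 0 -> same_line q (emb I z) ->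
  exists w, q = emb I w.
Proof.
intros HI Hz (K & HK & (u & v & ->) & (u' & v' & H)).
destruct (emb_unit_eq I K z (u', v') HI HK (eq_sym H) Hz) as [-> | ->].
- exists (u, v); reflexivity.
- exists (Cconj (u, v)); rewrite <- emb_opp_conj; reflexivity.
Qed.

Lemma holo_CpowZ I (z0 : C) n : imag_unit I ->
  holo I (fun z => (0 <= n)%Z \/ z <> z0) (fun z => emb I (CpowZ (Cminus z z0) n)).
Proof.
intros HI; destruct z0 as [x0 y0].
assert (Hpow : forall k, holo I (fun _ => True) (fun z => emb I (Cpow (Cminus z (x0, y0)) k))).
{ intros k; apply (holo_pow I (fun _ => True) (fun z => fst z + - x0) (fun z => snd z + - y0)
    (fun _ => 1) (fun _ => 0) k HI).
  intros x y _; split; [|split; cont].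
  refine (conj _ (conj _ (conj _ (conj _ (conj (continuous_const _ _) (continuous_const _ _))))));
    simpl; auto_derive; trivial; ring. }
destruct n as [|k|k].
- apply holo_ext_eq with (3 := Hpow 0%nat); [trivial | reflexivity].
- apply holo_ext_eq with (3 := Hpow (Pos.to_nat k)); [trivial | reflexivity].
- set (N := fun z : R * R => (fst z - x0) * (fst z - x0) + (snd z - y0) * (snd z - y0)).
  assert (HN : forall z, z <> (x0, y0) -> N z <> 0).
  { intros [x y] Hz H; unfold N in H; simpl in H; apply Hz.
    assert (S1 := Rle_0_sqr (x - x0)); assert (S2 := Rle_0_sqr (y - y0)); unfold Rsqr in S1, S2.
    f_equal; apply Rminus_diag_uniq, Rsqr_0_uniq; unfold Rsqr; lra. }
  assert (HNc : forall z, z <> (x0, y0) -> continuous (fun w => / N w) z).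
  { intros z Hz; apply (continuous_comp N Rinv); [unfold N; cont | apply continuous_Rinv, HN, Hz]. }
  (* The real and imaginary parts of [1 / (z - z0)], then those of its derivative
     [- 1 / (z - z0)^2]. *)
  destruct (holo_pow I (fun z => z <> (x0, y0))
    (fun z => (fst z - x0) * / N z) (fun z => - (snd z - y0) * / N z)
    (fun z => ((snd z - y0) * (snd z - y0) - (fst z - x0) * (fst z - x0)) * (/ N z * / N z))
    (fun z => 2 * ((fst z - x0) * (snd z - y0)) * (/ N z * / N z)) (Pos.to_nat k) HI) as [H _].
  + intros x y Hxy; assert (HNxy := HN _ Hxy); assert (Hc := HNc _ Hxy).
    split; [|split; cont].
    refine (conj _ (conj _ (conj _ (conj _ (conj _ _))))); [| | | |cont|cont];
    unfold N in *; simpl in *; auto_derive; try assumption; field; assumption.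
  + apply holo_ext_eq with (3 := H).
    * intros z [Hz|Hz]; [lia | exact Hz].
    * intros [x y]; simpl CpowZ; f_equal; f_equal.
      unfold N, Cminus, Cplus, Copp, Cinv, Rdiv; simpl fst; simpl snd.
      replace ((x + - x0) ^ 2 + (y + - y0) ^ 2) with
        ((x - x0) * (x - x0) + (y - y0) * (y - y0)) by ring.
      apply injective_projections; simpl; reflexivity.
Qed.

Lemma sphere_conj I J z w : imag_unit I -> imag_unit J -> w = z \/ w = Cconj z ->
  sphere (qre (emb I z)) (qabs (qim (emb I z))) (emb J w).
Proof.
intros HI HJ Hw; rewrite qre_emb, qabs_qim_emb by assumption.
assert (HJw : exists K, imag_unit K /\ emb J w = emb K z).
{ destruct Hw as [-> | ->]; [exists J; auto|].
  exists (opp J); split; [apply imag_unit_opp, HJ | symmetry; apply emb_opp_conj]. }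
destruct HJw as (K & HK & ->); destruct z as [x y]; simpl fst; simpl snd.
unfold Rabs; destruct (Rcase_abs y).
- exists (opp K); split; [apply imag_unit_opp, HK | clear; qring].
- exists K; split; [exact HK | reflexivity].
Qed.

(** The star power is the slice extension of the ordinary power. The extension also evaluates it at
    the conjugate point, so for [n < 0] both [z0] and its conjugate must be avoided: this removes
    the whole sphere. *)
Lemma star_pow_ext I (z0 : C) n : imag_unit I ->
  is_star_pow (emb I z0) n (ext_fun I (fun z => emb I (CpowZ (Cminus z z0) n))).
Proof.
intros HI; split.
- apply regular_holo; intros J HJ.
  apply holo_ext_eq with (D := fun z : C => (0 <= n)%Z \/ (z <> z0 /\ z <> Cconj z0))
    (g := ext I J (fun z => emb I (CpowZ (Cminus z z0) n))).
  + intros z [Hz|Hz]; [left; assumption | right].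
    split; intros E; apply Hz; apply (sphere_conj I J z0 z HI HJ); auto.
  + intros z; symmetry; apply ext_fun_emb, HJ.
  + apply holo_ext; [assumption | assumption | |].
    * intros z [Hz|[H1 H2]]; [left; assumption | right].
      split; intros E; [apply H2 | apply H1]; apply (f_equal Cconj) in E;
        rewrite ?Cconj_conj in E; exact E.
    * apply holo_ext_eq with (3 := holo_CpowZ I z0 n HI); [tauto | reflexivity].
- intros q _ HL.
  (* A real centre shares a line with every [q], so the value is checked on each slice: powers of
     [z - x0] commute with conjugation, and the extension to the slice of [K] is again the power. *)
  destruct (Req_dec (snd z0) 0) as [H0|H0].
  + destruct HL as (K & HK & (u & v & ->) & (u' & v' & H)).
    change (slice_pt K u v) with (emb K (u, v)).
    destruct z0 as [x0 y0]; simpl in H0; subst y0.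
    rewrite ext_fun_emb by assumption.
    rewrite emb_real, <- (emb_real K x0), emb_minus, qpowZ_emb by assumption.
    unfold ext.
    replace (Cminus (Cconj (u, v)) (x0, 0)) with (Cconj (Cminus (u, v) (x0, 0)))
      by (apply injective_projections; simpl; ring).
    rewrite CpowZ_conj; generalize (CpowZ (Cminus (u, v) (x0, 0)) n); clear - HI HK; intros [s t].
    unfold ext_l, ext_r; iring2 HI HK.
  + destruct (same_line_nonreal I z0 q HI H0 HL) as [w ->].
    rewrite ext_fun_emb, ext_same, emb_minus, qpowZ_emb by assumption; reflexivity.
Qed.

(** An expansion comes with unspecified functions [E n]; on the slice through the centre their
    values are forced. *)
Lemma star_pow_eval I z0 n E w : imag_unit I -> is_star_pow (emb I z0) n E ->
  (0 <= n)%Z \/ (w <> z0 /\ w <> Cconj z0) ->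
  E (emb I w) = emb I (CpowZ (Cminus w z0) n).
Proof.
intros HI [_ HE] Hw; rewrite HE.
- rewrite emb_minus; apply qpowZ_emb, HI.
- destruct Hw as [Hw|[H1 H2]]; [left; exact Hw | right].
  rewrite qre_emb, qabs_qim_emb by assumption; intros (K & HK & H).
  change (slice_pt K (fst z0) (Rabs (snd z0))) with (emb K (fst z0, Rabs (snd z0))) in H.
  assert (E1 := f_equal qre H); rewrite !qre_emb in E1 by assumption.
  assert (E2 := f_equal (fun q => qabs (qim q)) H); simpl in E2; rewrite !qabs_qim_emb in E2 by assumption.
  destruct w as [u v], z0 as [x y]; simpl in E1, E2; subst u.
  rewrite Rabs_Rabsolu in E2.
  assert (Hv : v = y \/ v = - y).
  { revert E2; unfold Rabs; destruct (Rcase_abs v), (Rcase_abs y); intros; lra. }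
  destruct Hv as [-> | ->]; [apply H1 | apply H2]; reflexivity.
- apply same_line_emb, HI.
Qed.

(** * Laurent expansions *)

Lemma Sigma0_same_line p q r : same_line q p ->
  (Sigma0 p r q <-> 0 < qabs (minus q p) < r).
Proof.
intros H; unfold Sigma0, Defs.tau, Defs.sigma.
destruct (excluded_middle_informative (same_line q p)); [reflexivity | contradiction].
Qed.

Lemma Sigma0_emb I z0 r z : imag_unit I ->
  (Sigma0 (emb I z0) r (emb I z) <-> z <> z0 /\ Cmod (Cminus z z0) < r).
Proof.
intros HI; rewrite Sigma0_same_line by apply same_line_emb, HI.
rewrite emb_minus, qabs_emb by assumption.
split; intros [H1 H2]; split; try assumption.
- intros ->; replace (Cminus z0 z0) with (RtoC 0) in H1 by ring; rewrite Cmod_0 in H1; lra.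
- apply Cmod_gt_0; intros E; apply H1.
  replace z with (Cplus (Cminus z z0) z0) by ring; rewrite E; ring.
Qed.

(** Off the line through [p], [sigma q p] is at least [|Im p|], so a radius of at most [|Im p|]
    leaves only points of the slice. *)
Lemma Sigma0_nonreal I z0 r q : imag_unit I -> snd z0 <> 0 -> r <= Rabs (snd z0) ->
  Sigma0 (emb I z0) r q ->
  exists z : C, q = emb I z /\ z <> z0 /\ Cmod (Cminus z z0) < r.
Proof.
intros HI Hz Hr HS.
destruct (excluded_middle_informative (same_line q (emb I z0))) as [HL|HL].
- destruct (same_line_nonreal I z0 q HI Hz HL) as [z ->]; exists z.
  split; [reflexivity | apply (Sigma0_emb I z0 r z HI), HS].
- exfalso; destruct HS as [_ HS]; revert HS; unfold Defs.sigma.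
  destruct (excluded_middle_informative (same_line q (emb I z0))); [contradiction|].
  rewrite qabs_qim_emb by assumption; apply Rle_not_lt.
  apply Rle_trans with (1 := Hr); rewrite <- (sqrt_pow2 (Rabs (snd z0))) at 1 by apply Rabs_pos.
  apply sqrt_le_1_alt.
  assert (H1 := Rabs_pos (snd z0)); assert (H2 : 0 <= qabs (qim q)) by apply sqrt_pos.
  assert (H3 := pow2_ge_0 (qre q - qre (emb I z0))).
  apply Rle_trans with ((qabs (qim q) + Rabs (snd z0)) ^ 2); [apply pow_incr; lra | lra].
Qed.

Lemma same_line_real x q : same_line q (quat_of_R x).
Proof.
destruct (emb_surj q) as (J & z & HJ & -> & _); rewrite <- (emb_real J x).
apply same_line_emb, HJ.
Qed.

Lemma open_quat (U : quat -> Prop) p : open U -> U p ->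
  exists r, 0 < r /\ forall q, qabs (minus q p) < r -> U q.
Proof.
intros HU Hp; destruct (HU p Hp) as [r Hr]; exists r; split; [apply cond_pos|].
intros q Hq; apply Hr, qabs_ball1, Hq.
Qed.

Lemma qabs_Sigma0 p r q : 0 < r -> (qim p <> zero -> r <= qabs (qim p)) ->
  Sigma0 p r q -> qabs (minus q p) < r.
Proof.
intros Hr0 Hr HS; destruct (emb_surj p) as (I & z0 & HI & -> & _).
destruct (Req_dec (snd z0) 0) as [H0|H0].
- destruct z0 as [x0 y0]; simpl in H0; subst y0; rewrite emb_real in *.
  apply (Sigma0_same_line _ _ _ (same_line_real x0 q)), HS.
- rewrite qabs_qim_emb in Hr by assumption.
  destruct (Sigma0_nonreal I z0 r q HI H0) as (z & -> & _ & Hz); [|assumption|].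
  + apply Hr; intros E; apply (f_equal qabs) in E.
    rewrite qabs_qim_emb in E by assumption; apply H0.
    change (Rabs (snd z0) = qabs zero) in E; rewrite qabs_0 in E.
    revert E; unfold Rabs; destruct (Rcase_abs (snd z0)); lra.
  + rewrite emb_minus, qabs_emb by assumption; exact Hz.
Qed.

Lemma singularity_of_open Omega' p : open Omega' -> Omega' p -> singularity Omega' p.
Proof.
intros Ho Hp; destruct (open_quat _ _ Ho Hp) as (r & Hr & HB).
destruct (excluded_middle_informative (qim p = zero)) as [E|E].
- exists r; split; [assumption|]; intros q Hq; apply HB, (qabs_Sigma0 p r q); auto; contradiction.
- assert (HP : 0 < qabs (qim p)).
  { destruct (Rle_lt_or_eq_dec 0 (qabs (qim p)) (sqrt_pos _)) as [|H]; [assumption|].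
    exfalso; apply E, qabs_eq_0; symmetry; exact H. }
  exists (Rmin r (qabs (qim p))); split; [apply Rmin_pos; assumption|].
  intros q Hq; apply HB.
  apply Rlt_le_trans with (2 := Rmin_l r (qabs (qim p))).
  apply qabs_Sigma0; [apply Rmin_pos; assumption | intros _; apply Rmin_r | exact Hq].
Qed.

Lemma CpowZ_nat c n : CpowZ c (Z.of_nat n) = Cpow c n.
Proof.
destruct n as [|n]; [reflexivity|].
change (CpowZ c (Z.of_nat (S n))) with (Cpow c (Pos.to_nat (Pos.of_succ_nat n))).
rewrite SuccNat2Pos.id_succ; reflexivity.
Qed.

Definition nat_coeffs (a : nat -> quat) (n : Z) : quat :=
  if Z_le_dec 0 n then a (Z.to_nat n) else zero.

Lemma is_Zseries_nat (e : Z -> quat) (a : nat -> quat) (s : quat) :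
  is_series (V := quat_NormedModule) (fun n => mult (e (Z.of_nat n)) (a n)) s ->
  is_Zseries (fun n => mult (e n) (nat_coeffs a n)) s.
Proof.
intros H; exists s, zero; repeat split.
- apply is_series_qeq with (1 := H); [|reflexivity].
  intros n; unfold nat_coeffs; destruct (Z_le_dec 0 (Z.of_nat n)); [|lia].
  rewrite Nat2Z.id; reflexivity.
- apply is_series_q0; intros n; unfold nat_coeffs.
  destruct (Z_le_dec 0 (- Z.of_nat (S n))); [lia|].
  generalize (e (- Z.of_nat (S n))%Z); clear; qring.
- clear; qring.
Qed.

Lemma vanishes_below_nat a m : vanishes_below (nat_coeffs a) m.
Proof.
intros k Hk; unfold nat_coeffs; destruct (Z_le_dec 0 (- Z.of_nat k)); [lia | reflexivity].
Qed.

Lemma Sigma0_mono p r r' q : r <= r' -> Sigma0 p r q -> Sigma0 p r' q.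
Proof. intros Hr [H1 H2]; split; lra. Qed.

(* At a real point the expansions on the various slices share their
   coefficients, which are determined by the restriction to the real line. *)
Lemma regular_series_real U g x0 r0 r : regular U g -> 0 < r < r0 ->
  (forall q, qabs (minus q (quat_of_R x0)) < r0 -> U q) ->
  exists a : nat -> quat, forall J z, imag_unit J -> Cmod (Cminus z (x0, 0)) < r ->
    is_series (V := quat_NormedModule) (fun n => mult (emb J (Cpow (Cminus z (x0, 0)) n)) (a n))
      (g (emb J z)).
Proof.
intros Hg Hr HU.
assert (HJ : forall J, imag_unit J -> exists a : nat -> quat, forall z : C, Cmod (Cminus z (x0, 0)) < r ->
  is_series (V := quat_NormedModule) (fun n => mult (emb J (Cpow (Cminus z (x0, 0)) n)) (a n)) (g (emb J z))).
{ intros J HJ; apply (holo_series J (slice U J) (fun z => g (emb J z)) (x0, 0) r0 r HJ Hr).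
  - apply regular_holo; assumption.
  - intros z Hz; apply HU; change (qabs (minus (emb J z) (quat_of_R x0)) < r0).
    rewrite <- (emb_real J), emb_minus, qabs_emb by assumption; exact Hz. }
destruct imag_unit_exists as [I HI]; destruct (HJ I HI) as [a Ha]; exists a.
intros J z HJu Hz; destruct (HJ J HJu) as [b Hb].
apply is_series_qeq with (1 := Hb z Hz); [|reflexivity].
intros n; f_equal; symmetry.
apply (quat_power_series_unique a b r); [lra|].
intros t Ht.
assert (Hs : forall K c, (forall z : C, Cmod (Cminus z (x0, 0)) < r ->
  is_series (V := quat_NormedModule) (fun n => mult (emb K (Cpow (Cminus z (x0, 0)) n)) (c n)) (g (emb K z))) ->
  is_series (V := quat_NormedModule) (fun n => scal (t ^ n) (c n)) (g (quat_of_R (x0 + t)))).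
{ intros K c Hc; specialize (Hc (x0 + t, 0)).
  replace (Cminus (x0 + t, 0) (x0, 0)) with (RtoC t) in Hc
    by (apply injective_projections; simpl; ring).
  rewrite Cmod_R, emb_real in Hc.
  apply is_series_qeq with (1 := Hc Ht); [|reflexivity].
  intros m; apply emb_pow_real. }
exists (g (quat_of_R (x0 + t))); split; [apply (Hs I), Ha | apply (Hs J), Hb].
Qed.

(** The Taylor series of [g] serves as a Laurent series without negative terms. At real [p] the set
    [Sigma0] meets every slice and one sequence of coefficients must serve them all; at nonreal [p]
    the radius is capped by [|Im p|], which leaves a single slice. *)
Lemma pole_of_extension Omega' f p U g :
  singularity Omega' p -> open U -> U p -> regular U g ->
  (forall q, U q -> Omega' q -> g q = f q) -> pole Omega' f p.
Proof.
intros (r1 & Hr1 & HS) HUo HUp Hg Hgf.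
destruct (open_quat _ _ HUo HUp) as (r2 & Hr2 & HU).
destruct (emb_surj p) as (I & z0 & HI & -> & _).
destruct (Req_dec (snd z0) 0) as [H0|H0].
- destruct z0 as [x0 y0]; simpl in H0; subst y0.
  rewrite emb_real in HU.
  destruct (regular_series_real U g x0 r2 (r2 / 2) Hg ltac:(lra) HU) as [a Ha].
  exists (nat_coeffs a); split; [|exists 0%nat; apply vanishes_below_nat].
  exists (Rmin r1 (r2 / 2)); split; [apply Rmin_pos; lra|].
  assert (HO : forall q, Sigma0 (emb I (x0, 0)) (Rmin r1 (r2 / 2)) q -> Omega' q).
  { intros q Hq; apply HS; apply Sigma0_mono with (2 := Hq), Rmin_l. }
  split; [exact HO|].
  exists (fun n => ext_fun I (fun z => emb I (CpowZ (Cminus z (x0, 0)) n))).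
  split; [intros n; apply star_pow_ext, HI|].
  intros q Hq; assert (HOq := HO q Hq).
  destruct (emb_surj q) as (J & z & HJ & -> & _).
  (* A real centre reads the same in every slice, so the star powers built from [I] can be evaluated
     along [J]. *)
  assert (HE : forall n, is_star_pow (emb J (x0, 0)) n
    (ext_fun I (fun z => emb I (CpowZ (Cminus z (x0, 0)) n)))).
  { intros n; rewrite emb_real, <- (emb_real I x0); apply star_pow_ext, HI. }
  rewrite emb_real, <- (emb_real J x0) in Hq.
  apply (Sigma0_emb J (x0, 0) _ z HJ) in Hq; destruct Hq as [Hz Hzr].
  assert (Hzr' : Cmod (Cminus z (x0, 0)) < r2 / 2) by (apply Rlt_le_trans with (1 := Hzr), Rmin_r).
  rewrite <- (Hgf (emb J z)); [|apply HU|exact HOq].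
  + apply is_Zseries_nat.
    apply is_series_qeq with (1 := Ha J z HJ Hzr'); [|reflexivity].
    intros n; rewrite (star_pow_eval J (x0, 0) _ _ z HJ (HE _)) by (left; lia).
    rewrite CpowZ_nat; reflexivity.
  + rewrite <- (emb_real J), emb_minus, qabs_emb by assumption; lra.
- assert (HD : forall z : C, Cmod (Cminus z z0) < r2 -> slice U I z).
  { intros z Hz; apply HU; change (qabs (minus (emb I z) (emb I z0)) < r2).
    rewrite emb_minus, qabs_emb by assumption; exact Hz. }
  destruct (holo_series I (slice U I) (fun z => g (emb I z)) z0 r2 (r2 / 2) HI ltac:(lra)
    (proj1 (regular_holo U g) Hg I HI) HD) as [a Ha].
  assert (HP : 0 < Rabs (snd z0)) by (apply Rabs_pos_lt, H0).
  set (r := Rmin r1 (Rmin (r2 / 2) (Rabs (snd z0)))).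
  assert (Hr : 0 < r) by (repeat apply Rmin_pos; lra).
  assert (Hrr1 : r <= r1) by apply Rmin_l.
  assert (Hrr2 : r <= r2 / 2) by (apply Rle_trans with (1 := Rmin_r _ _), Rmin_l).
  assert (Hrr3 : r <= Rabs (snd z0)) by (apply Rle_trans with (1 := Rmin_r _ _), Rmin_r).
  clearbody r.
  exists (nat_coeffs a); split; [|exists 0%nat; apply vanishes_below_nat].
  exists r; split; [assumption|].
  assert (HO : forall q, Sigma0 (emb I z0) r q -> Omega' q).
  { intros q Hq; apply HS; apply Sigma0_mono with (2 := Hq); assumption. }
  split; [exact HO|].
  exists (fun n => ext_fun I (fun z => emb I (CpowZ (Cminus z z0) n))).
  split; [intros n; apply star_pow_ext, HI|].
  intros q Hq; assert (HOq := HO q Hq).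
  destruct (Sigma0_nonreal I z0 r q HI H0 Hrr3 Hq) as (z & -> & Hz & Hzr).
  rewrite <- (Hgf (emb I z)); [|apply HD; lra|exact HOq].
  apply is_Zseries_nat.
  apply is_series_qeq with (1 := Ha z ltac:(lra)); [|reflexivity].
  intros n; rewrite (star_pow_eval I z0 _ _ z HI (star_pow_ext I z0 _ HI)) by (left; lia).
  rewrite CpowZ_nat; reflexivity.
Qed.

(** Regular and removable points are poles of order [0]; at a regular point [f] is its own
    extension, with [U = Omega']. *)
Lemma semiregular_pole Omega Omega' f q : semiregular Omega Omega' f -> Omega q -> pole Omega' f q.
Proof.
intros (_ & _ & [[Ho _] _] & Hf & HP) Hq.
destruct (excluded_middle_informative (Omega' q)) as [H|H].
- apply (pole_of_extension Omega' f q Omega' f); auto using singularity_of_open.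
- destruct (HP q Hq H) as [|[HS (U & g & HU & HUq & Hg & Hgf)]]; [assumption|].
  apply (pole_of_extension Omega' f q U g); assumption.
Qed.

(** * Orders on a sphere *)

Lemma least_nat (P : nat -> Prop) n : P n -> exists m, P m /\ forall k, P k -> (m <= k)%nat.
Proof.
revert n; apply (well_founded_induction lt_wf (fun n => P n -> _)); intros n IH Hn.
destruct (excluded_middle_informative (exists k, P k /\ (k < n)%nat)) as [(k & Hk & Hkn)|H].
- exact (IH k Hkn Hk).
- exists n; split; [assumption|]; intros k Hk.
  destruct (Nat.le_gt_cases n k); [assumption|]; exfalso; apply H; exists k; split; assumption.
Qed.

Lemma is_ord_of_vanishing Omega' f p a m : is_Laurent Omega' f p a -> vanishes_below a m ->
  exists n, (n <= m)%nat /\ is_ord Omega' f p n.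
Proof.
intros HL Hm; destruct (least_nat (vanishes_below a) m Hm) as (n & Hn & Hmin).
exists n; split; [apply Hmin, Hm | exists a; auto].
Qed.

Lemma is_ord_of_coeff Omega' f p a m : is_Laurent Omega' f p a -> vanishes_below a m ->
  (m = 0%nat \/ a (- Z.of_nat m)%Z <> zero) -> is_ord Omega' f p m.
Proof.
intros HL Hm Ha; exists a; repeat split; try assumption.
intros k Hk; destruct Ha as [->|Ha]; [lia|].
destruct (Nat.le_gt_cases m k) as [|H]; [assumption|].
exfalso; apply Ha, Hk, H.
Qed.

Lemma is_Zseries_comb (u v w : Z -> quat) (s t c d : quat) :
  is_Zseries u s -> is_Zseries v t ->
  (forall n, w n = plus (mult c (u n)) (mult d (v n))) ->
  is_Zseries w (plus (mult c s) (mult d t)).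
Proof.
intros (s1 & s2 & Hs1 & Hs2 & ->) (t1 & t2 & Ht1 & Ht2 & ->) Hw.
exists (plus (mult c s1) (mult d t1)), (plus (mult c s2) (mult d t2)); repeat split.
- eapply is_series_qeq; [apply is_series_qplus; apply is_series_qmult; [exact Hs1 | exact Ht1] | |reflexivity].
  intros n; symmetry; apply Hw.
- eapply is_series_qeq; [apply is_series_qplus; apply is_series_qmult; [exact Hs2 | exact Ht2] | |reflexivity].
  intros n; symmetry; apply Hw.
- clear; qring.
Qed.

(** The conjugate of [z0] is set aside because it lies on the sphere where negative star powers are
    undefined. *)
Lemma is_Laurent_emb Omega' f I z0 a : imag_unit I -> is_Laurent Omega' f (emb I z0) a ->
  exists r, 0 < r /\ forall z : C, z <> z0 -> z <> Cconj z0 -> Cmod (Cminus z z0) < r ->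
    Omega' (emb I z) /\
    is_Zseries (fun n => mult (emb I (CpowZ (Cminus z z0) n)) (a n)) (f (emb I z)).
Proof.
intros HI (r & Hr & HS & E & HE & Hf); exists r; split; [assumption|].
intros z Hz Hzc Hzr.
assert (HSz : Sigma0 (emb I z0) r (emb I z)) by (apply Sigma0_emb; auto).
split; [apply HS, HSz|].
destruct (Hf _ HSz) as (s1 & s2 & H1 & H2 & H3); exists s1, s2; split; [|split].
- apply is_series_qeq with (1 := H1); [|reflexivity].
  intros n; f_equal; apply star_pow_eval; auto.
- apply is_series_qeq with (1 := H2); [|reflexivity].
  intros n; f_equal; apply star_pow_eval; auto.
- exact H3.
Qed.

Lemma ext_l_emb I J c q : imag_unit I -> imag_unit J ->
  mult (ext_l I J) (mult (emb I c) q) = mult (emb J c) (mult (ext_l I J) q).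
Proof.
intros HI HJ; rewrite !mult_emb, ext_l_comm by assumption.
generalize (ext_l I J) (mult I q) (fst c) (snd c); clear; qring.
Qed.

(** Since [J B = B (- I)], the factor [B] carries scalars from the line of [- I] to that of [J];
    this is why the second expansion is read along [opp I]. *)
Lemma ext_r_emb I J c q : imag_unit I -> imag_unit J ->
  mult (ext_r I J) (mult (emb (opp I) c) q) = mult (emb J c) (mult (ext_r I J) q).
Proof.
intros HI HJ; rewrite !mult_emb, ext_r_comm by assumption.
replace (mult (opp I) q) with (opp (mult I q)) by (clear; qring).
generalize (ext_l I J) (ext_r I J) (mult I q) (fst c) (snd c); clear; qring.
Qed.

(* Since [r <= |y|], the set [Sigma0] is a punctured disc in [R + J R], where
   [f] is recovered from the slices [I] and [- I]. *)
Lemma is_Laurent_transfer Omega' f I J z0 a a' :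
  symmetric Omega' -> slice_domain Omega' -> regular Omega' f ->
  imag_unit I -> imag_unit J -> snd z0 <> 0 ->
  is_Laurent Omega' f (emb I z0) a -> is_Laurent Omega' f (emb (opp I) z0) a' ->
  is_Laurent Omega' f (emb J z0)
    (fun n => plus (mult (ext_l I J) (a n)) (mult (ext_r I J) (a' n))).
Proof.
intros HS HD Hf HI HJ H0 Ha Ha'.
assert (HI' := imag_unit_opp I HI).
destruct (is_Laurent_emb _ _ _ _ _ HI Ha) as (r1 & Hr1 & H1).
destruct (is_Laurent_emb _ _ _ _ _ HI' Ha') as (r2 & Hr2 & H2).
assert (HP : 0 < Rabs (snd z0)) by (apply Rabs_pos_lt, H0).
set (r := Rmin r1 (Rmin r2 (Rabs (snd z0)))).
assert (Hr : 0 < r) by (repeat apply Rmin_pos; lra).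
assert (Hrr1 : r <= r1) by apply Rmin_l.
assert (Hrr2 : r <= r2) by (apply Rle_trans with (1 := Rmin_r _ _), Rmin_l).
assert (Hrr3 : r <= Rabs (snd z0)) by (apply Rle_trans with (1 := Rmin_r _ _), Rmin_r).
clearbody r.
assert (Hdisc : forall q, Sigma0 (emb J z0) r q ->
  exists z : C, q = emb J z /\ z <> z0 /\ z <> Cconj z0 /\ Cmod (Cminus z z0) < r).
{ intros q Hq; destruct (Sigma0_nonreal J z0 r q HJ H0 Hrr3 Hq) as (z & -> & Hz & Hzr).
  exists z; repeat split; try assumption.
  (* The conjugate of [z0] is at distance [2 |y|] from [z0], beyond the radius [r <= |y|]. *)
  intros ->; apply (Rlt_irrefl r); apply Rle_lt_trans with (2 := Hzr).
  apply Rle_trans with (1 := Hrr3).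
  assert (HM := Rmax_Cmod (Cminus (Cconj z0) z0)).
  apply Rle_trans with (2 := HM), Rle_trans with (2 := Rmax_r _ _).
  destruct z0 as [x0 y0]; simpl.
  replace (- y0 + - y0) with (- (2 * y0)) by ring.
  rewrite Rabs_Ropp, Rabs_mult, (Rabs_pos_eq 2) by lra; simpl in HP; lra. }
exists r; split; [assumption|]; split.
- intros q Hq; destruct (Hdisc q Hq) as (z & -> & Hz & Hzc & Hzr).
  apply (symmetric_emb Omega' I J); try assumption; apply H1; auto; lra.
- exists (fun n => ext_fun J (fun z => emb J (CpowZ (Cminus z z0) n))).
  split; [intros n; apply star_pow_ext, HJ|].
  intros q Hq; destruct (Hdisc q Hq) as (z & -> & Hz & Hzc & Hzr).
  destruct (H1 z Hz Hzc ltac:(lra)) as [HO1 HZ1], (H2 z Hz Hzc ltac:(lra)) as [HO2 HZ2].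
  rewrite (representation Omega' f I J) by
    (try assumption; apply (symmetric_emb Omega' I J); assumption).
  (* [x - I y] becomes the point with the same coordinate [z] on the slice of [- I], where the
     second expansion applies. *)
  unfold ext; rewrite <- (emb_opp_conj I).
  apply is_Zseries_comb with (1 := HZ1) (2 := HZ2).
  intros n; rewrite ext_l_emb, ext_r_emb by assumption.
  rewrite (star_pow_eval J z0 n _ z HJ (star_pow_ext J z0 n HJ)) by auto.
  generalize (emb J (CpowZ (Cminus z z0) n)) (mult (ext_l I J) (a n)) (mult (ext_r I J) (a' n)).
  clear; qring.
Qed.

Lemma qmult_integral (p q : quat) : mult p q = zero -> p = zero \/ q = zero.
Proof.
intros H; apply (f_equal qabs) in H; rewrite qabs_mult in H.
change (qabs p * qabs q = qabs zero) in H; rewrite qabs_0 in H.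
apply Rmult_integral in H; destruct H; [left | right]; apply qabs_eq_0; assumption.
Qed.

Lemma qminus_eq_0 (p q : quat) : minus p q = zero -> p = q.
Proof.
destruct p as [[[? ?] ?] ?], q as [[[? ?] ?] ?]; intros H; injection H; intros.
apply quat_ext; lra.
Qed.

(* The coefficient is [alpha + J beta] with [alpha = (b + c) / 2] and
   [beta = - I (b - c) / 2]. *)
Lemma ext_zero_unique I J K b c : imag_unit I ->
  plus (mult (ext_l I J) b) (mult (ext_r I J) c) = zero ->
  plus (mult (ext_l I K) b) (mult (ext_r I K) c) = zero ->
  J = K \/ (b = zero /\ c = zero).
Proof.
intros HI HJ HK.
(* Subtracting the two equations cancels [alpha] and leaves [(J - K) beta], up to a real factor. If
   [J <> K] then [b = c], and [A + B = 1] reduces the first equation to [b = zero]. *)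
assert (H : mult (minus J K) (mult I (minus c b)) = zero).
{ transitivity (scal 2 (minus (plus (mult (ext_l I J) b) (mult (ext_r I J) c))
    (plus (mult (ext_l I K) b) (mult (ext_r I K) c)))).
  - unfold ext_l, ext_r; clear; qcases; apply quat_ext; field.
  - rewrite HJ, HK; clear; qring. }
destruct (qmult_integral _ _ H) as [E|E]; [left; apply qminus_eq_0, E | right].
destruct (qmult_integral _ _ E) as [E1|E1].
- exfalso; assert (H1 := qabs_imag I HI); rewrite E1 in H1.
  change (qabs zero = 1) in H1; rewrite qabs_0 in H1; lra.
- apply qminus_eq_0 in E1; subst c; rewrite ext_lr_real in HJ; auto.
Qed.

Theorem theorem7p6 :
  forall (Omega Omega' : quat -> Prop) (f : quat -> quat),
  symmetric Omega -> slice_domain Omega ->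
  semiregular Omega Omega' f ->
  forall x y : R,
  (forall q, sphere x y q -> Omega q) ->
  exists N : nat,
    (forall q, sphere x y q -> is_ord Omega' f q N) \/
    (exists q0, sphere x y q0 /\
       (forall q, sphere x y q -> q <> q0 -> is_ord Omega' f q N) /\
       (exists m : nat, (m < N)%nat /\ is_ord Omega' f q0 m)).
Proof.
intros Omega Omega' f _ _ Hsemi x y Hsph.
assert (Hpole : forall J, imag_unit J -> pole Omega' f (emb J (x, y))).
{ intros J HJ; apply (semiregular_pole Omega); [assumption|].
  apply Hsph; exists J; split; [assumption | reflexivity]. }
destruct Hsemi as (_ & HS & HD & Hf & _).
destruct imag_unit_exists as [I HI].
destruct (Hpole I HI) as (a & Ha & m1 & Hm1).
(* For [y = 0] the sphere is a single real point, so there is nothing to compare. *)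
destruct (Req_dec y 0) as [->|Hy].
{ destruct (is_ord_of_vanishing _ _ _ _ _ Ha Hm1) as (N & _ & HN).
  exists N; left; intros q (J & HJ & ->).
  change (slice_pt J x 0) with (emb J (x, 0)); rewrite emb_real in *; exact HN. }
destruct (Hpole (opp I) (imag_unit_opp I HI)) as (a' & Ha' & m2 & Hm2).
(* [N] is the least bound common to both reference sequences, so for [N > 0] the two coefficients at
   index [- N] are not both zero. *)
destruct (least_nat (fun m => vanishes_below a m /\ vanishes_below a' m) (Nat.max m1 m2))
  as (N & [HN HN'] & Hmin).
{ split; intros k Hk; [apply Hm1 | apply Hm2]; lia. }
set (coeff := fun J n => plus (mult (ext_l I J) (a n)) (mult (ext_r I J) (a' n))).
assert (HL : forall J, imag_unit J -> is_Laurent Omega' f (emb J (x, y)) (coeff J)).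
{ intros J HJ; apply is_Laurent_transfer; assumption. }
assert (Hcoeff : forall J n, a n = zero -> a' n = zero -> coeff J n = zero).
{ intros J n E E'; unfold coeff; rewrite E, E'; generalize (ext_l I J) (ext_r I J); clear; qring. }
assert (HV : forall J, vanishes_below (coeff J) N).
{ intros J k Hk; apply Hcoeff; [apply HN | apply HN']; assumption. }
assert (HNz : N = 0%nat \/ ~ (a (- Z.of_nat N)%Z = zero /\ a' (- Z.of_nat N)%Z = zero)).
{ destruct (Nat.eq_dec N 0) as [|HN0]; [left; assumption | right; intros [E E']].
  assert (H : (N <= N - 1)%nat); [|lia].
  apply Hmin; split; intros k Hk; destruct (Nat.eq_dec k N) as [->|]; auto;
    [apply HN | apply HN']; lia. }
exists N.
(* [N <> 0] is part of the condition because the coefficient at index [0] may vanish without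
   lowering an order that is already [0]. *)
destruct (excluded_middle_informative
  (exists J, imag_unit J /\ N <> 0%nat /\ coeff J (- Z.of_nat N)%Z = zero))
  as [(J0 & HJ0 & HN0 & E0)|Hno].
- right; exists (emb J0 (x, y)); split; [exists J0; split; [assumption | reflexivity] | split].
  + intros q (J & HJ & ->) Hq; apply (is_ord_of_coeff _ _ _ _ _ (HL J HJ) (HV J)).
    right; intros E.
    destruct (ext_zero_unique I J J0 _ _ HI E E0) as [->|H]; [apply Hq; reflexivity|].
    destruct HNz as [|HNz]; [contradiction | exact (HNz H)].
  (* At [J0] the coefficient at index [- N] also vanishes, so the bound drops to [N - 1], a true
     predecessor since [N <> 0]. *)
  + destruct (is_ord_of_vanishing _ _ _ _ (N - 1) (HL J0 HJ0)) as (m & Hm & Hord).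
    * intros k Hk; destruct (Nat.eq_dec k N) as [->|]; [assumption | apply HV; lia].
    * exists m; split; [lia | assumption].
- left; intros q (J & HJ & ->); apply (is_ord_of_coeff _ _ _ _ _ (HL J HJ) (HV J)).
  destruct (Nat.eq_dec N 0) as [|HN0]; [left; assumption | right; intros E].
  apply Hno; exists J; auto.
Qed.
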